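(* There exists $M_0$ such that for every $T$-invariant probability measure $\mu$ on $X$ and every $M\geq M_0$, $$h_\mu(T)\leq 1+\frac{\log\log M}{\log M}-\frac{\mu(X_{\geq M})}{2}.$$ In particular, if $(\mu_i)$ is a sequence of $T$-invariant probability measures with $h_{\mu_i}(T)\geq c$ for all $i$, then any weak-* limit $\mu$ of $(\mu_i)$ satisfies $\mu(X)\geq 2c-1$.
   Context: $X=\mathrm{SL}_2(\mathbb{Z})\backslash\mathrm{SL}_2(\mathbb{R})$, identified with covolume-one lattices in $\mathbb{R}^2$; $\mathrm{ht}(x)=(\min_{v\in L\setminus\{0\}}\|v\|)^{-1}$ for the lattice $L$ of $x$; $X_{\geq M}=\{\mathrm{ht}\geq M\}$. $T(x)=x\,\mathrm{diag}(e^{1/2},e^{-1/2})$ is the time-one map of the geodesic flow and $h_\mu(T)$ its measure-theoretic entropy. *)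

(* Defs.v *)
From HB Require Import structures.
From mathcomp Require Import all_boot all_order all_algebra.
From mathcomp Require Import generic_quotient.
From mathcomp Require Import all_classical all_reals all_analysis.

Set Implicit Arguments.
Unset Strict Implicit.
Unset Printing Implicit Defensive.

Import Order.TTheory GRing.Theory Num.Theory.
Import numFieldNormedType.Exports.

Local Open Scope classical_set_scope.
Local Open Scope ring_scope.
Local Open Scope quotient_scope.

(* The topology on [SL2 R] is the one induced by the entrywise topology. *)
Definition SL2 (R : realType) : Type :=
  set_type [set g : 'M[R]_2 | \det g = 1].
HB.instance Definition _ (R : realType) :=
  Topological.copy (SL2 R) (set_type [set g : 'M[R]_2 | \det g = 1]).

Section modular_surface.
Variable R : realType.

Definition SL2mx (g : SL2 R) : 'M[R]_2 := sval g.
Coercion SL2mx : SL2 >-> matrix.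

Lemma det_SL2 (g : SL2 R) : \det g = 1.
Proof. by have := set_mem (svalP g). Qed.

Lemma SL2_inj : injective SL2mx.
Proof. exact: val_inj. Qed.

Definition mkSL2 (g : 'M[R]_2) (detg : \det g = 1) : SL2 R :=
  exist _ g (mem_set detg).

Lemma SL2_mul_subproof (g h : SL2 R) : \det (SL2mx g *m SL2mx h) = 1.
Proof. by rewrite det_mulmx !det_SL2 mulr1. Qed.
Definition SL2_mul g h : SL2 R := mkSL2 (SL2_mul_subproof g h).

Definition SL2_1 : SL2 R := mkSL2 (det1 R 2).

Definition in_SL2Z_orbit (g h : SL2 R) : Prop :=
  exists2 u : 'M[int]_2, \det u = 1 & SL2mx h = map_mx intr u *m SL2mx g.

Lemma in_SL2Z_orbit_refl : reflexive (fun g h => `[< in_SL2Z_orbit g h >]).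
Proof.
move=> g; apply/asboolP; exists 1%:M; first exact: det1.
by rewrite map_mx1 mul1mx.
Qed.

Lemma in_SL2Z_orbitC g h : in_SL2Z_orbit g h -> in_SL2Z_orbit h g.
Proof.
move=> [u du hE]; exists (\adj u).
  by have := congr1 determinant (mul_adj_mx u); rewrite det_mulmx du det1 mulr1.
by rewrite hE mulmxA -map_mxM mul_adj_mx du map_mx1 mul1mx.
Qed.

Lemma in_SL2Z_orbit_sym : symmetric (fun g h => `[< in_SL2Z_orbit g h >]).
Proof. by move=> g h; apply/asboolP/asboolP; exact: in_SL2Z_orbitC. Qed.

Lemma in_SL2Z_orbit_trans : transitive (fun g h => `[< in_SL2Z_orbit g h >]).
Proof.
move=> h g k /asboolP[u du hE] /asboolP[v dv kE]; apply/asboolP.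
exists (v *m u); first by rewrite det_mulmx du dv mulr1.
by rewrite kE hE map_mxM mulmxA.
Qed.

Canonical SL2Z_orbit_equiv :=
  EquivRel _ in_SL2Z_orbit_refl in_SL2Z_orbit_sym in_SL2Z_orbit_trans.

End modular_surface.

Definition SL2ZSL2R (R : realType) : Type :=
  quotient_topology {eq_quot (SL2Z_orbit_equiv R)}.
HB.instance Definition _ (R : realType) := Topological.copy (SL2ZSL2R R)
  (quotient_topology {eq_quot (SL2Z_orbit_equiv R)}).
HB.instance Definition _ (R : realType) := Quotient.copy (SL2ZSL2R R)
  (quotient_topology {eq_quot (SL2Z_orbit_equiv R)}).
HB.instance Definition _ (R : realType) :=
  isPointed.Build (SL2ZSL2R R) (\pi_(SL2ZSL2R R) (SL2_1 R)).
HB.instance Definition _ (R : realType) :=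
  @isMeasurable.Build (sigma_display (@open (SL2ZSL2R R))) (SL2ZSL2R R)
    <<s @open (SL2ZSL2R R) >>
    (@sigma_algebra0 _ setT (@open (SL2ZSL2R R)))
    (@sigma_algebraC _ (@open (SL2ZSL2R R)))
    (@sigma_algebra_bigcup _ setT (@open (SL2ZSL2R R))).

Section height_and_geodesic_flow.
Variable R : realType.
Local Notation X := (SL2ZSL2R R).

Definition lattice (x : X) : set 'rV[R]_2 :=
  [set map_mx intr m *m SL2mx (repr x) | m in [set: 'rV[int]_2]].

Lemma eq_orbit_repr (g : SL2 R) : in_SL2Z_orbit g (repr (\pi_X g)).
Proof.
have /eqmodP /asboolP // : g = repr (\pi_X g) %[mod {eq_quot (SL2Z_orbit_equiv R)}].
by rewrite [RHS]reprK.
Qed.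

Lemma lattice_pi (g : SL2 R) :
  lattice (\pi_X g) = [set map_mx intr m *m SL2mx g | m in [set: 'rV[int]_2]].
Proof.
have [u _ rE] := eq_orbit_repr g.
have [v _ gE] := in_SL2Z_orbitC (eq_orbit_repr g).
apply/seteqP; split => _ /= [m _ <-].
  by exists (m *m u) => //; rewrite rE map_mxM mulmxA.
by exists (m *m v) => //; rewrite [in RHS]gE map_mxM mulmxA.
Qed.

(* The norm instance of 'rV[R]_2 is the sup norm, hence this definition. *)
Definition euclidean_norm (v : 'rV[R]_2) : R :=
  Num.sqrt (\sum_j v ord0 j ^+ 2).

(* Lattices being discrete, the infimum is a minimum. *)
Definition height (x : X) : R :=
  (inf [set euclidean_norm v | v in lattice x `\ 0])^-1.

Definition height_ge (M : R) : set X := [set x | M <= height x].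

Definition geodesic_mx : 'M[R]_2 :=
  diag_mx (\row_(j < 2) if j == ord0 then expR (2^-1) else expR (- 2^-1)).

Lemma det_geodesic_mx : \det geodesic_mx = 1.
Proof.
by rewrite det_diag big_ord_recl big_ord1 !mxE /= -expRD subrr expR0.
Qed.

Definition geodesic_map (x : X) : X :=
  \pi_X (SL2_mul (repr x) (mkSL2 det_geodesic_mx)).

Lemma geodesic_map_pi (g : SL2 R) :
  geodesic_map (\pi_X g) = \pi_X (SL2_mul g (mkSL2 det_geodesic_mx)).
Proof.
have [u du rE] := in_SL2Z_orbitC (eq_orbit_repr g).
apply/eqmodP/asboolP; exists u => //.
by rewrite /= mulmxA -rE.
Qed.

End height_and_geodesic_flow.

Section entropy.
Context d (T : measurableType d) (R : realType).
Variables (mu : {measure set T -> \bar R}) (f : T -> T).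

Definition invariant_measure : Prop :=
  forall A, measurable A -> mu (f @^-1` A) = mu A.

(* Cells of null measure contribute [0 * ln 0 = 0]. *)
Definition shannon_entropy (I : finType) (P : I -> set T) : R :=
  - \sum_i fine (mu (P i)) * ln (fine (mu (P i))).

(* The join of the [f^-j P], [j < n], whose cells are indexed by words. *)
Definition dynamical_join k (P : 'I_k -> set T) n (w : {ffun 'I_n -> 'I_k}) :
    set T :=
  \bigcap_(j in [set: 'I_n]) (iter j f @^-1` P (w j)).

Definition entropy_partition k (P : 'I_k -> set T) : R :=
  limn (fun n => shannon_entropy (dynamical_join P (n := n)) / n%:R).

Definition measure_entropy : \bar R :=
  ereal_sup [set h | exists k (P : 'I_k -> set T),
    [/\ forall i, measurable (P i), partition setT P setT
      & h = (entropy_partition P)%:E]].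

End entropy.

Section weak_star.
Variable R : realType.
Local Notation X := (SL2ZSL2R R).

(* Test functions [f >= 0] force the limit [mu] to be finite on compact sets,
   i.e. Radon, so this need not be assumed. *)
Definition weak_star_cvg (mu_ : nat -> {measure set X -> \bar R})
    (mu : {measure set X -> \bar R}) : Prop :=
  forall f : X -> R, continuous f -> compact (closure [set x | f x != 0]) ->
  (\int[mu_ n]_x (f x)%:E)%E @[n --> \oo] --> (\int[mu]_x (f x)%:E)%E.

(* Limits along subsequences: [mu_] need not converge as a whole. *)
Definition weak_star_limit (mu_ : nat -> {measure set X -> \bar R})
    (mu : {measure set X -> \bar R}) : Prop :=
  exists2 phi : nat -> nat, {homo phi : m n / (m < n)%N} &
    weak_star_cvg (mu_ \o phi) mu.

End weak_star.

(* Main.v *)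
(** The entropy of a partition is bounded by Gibbs' inequality against an
    explicit distribution on words of length [n].  An orbit is first coded by
    its pattern, the set of times spent in the cusp [height >= M], with a
    Markov weight switching state with probability [1 / ln M]: two visits to
    the cusp by different lattice vectors are [4 ln M] apart, so patterns cost
    [O (ln (ln M) / ln M)] per unit of time.  Given the pattern [V], the orbit is
    coded by a Bowen ball, and about [exp (n - #|V| / 2)] balls suffice: during
    a stay of length [L] in the cusp the short vector is contracted and
    expanded again, so its slope, hence the unstable coordinate of the orbit,
    is known up to [exp (- L / 2)].  Within a Bowen ball the word is almost
    determined, because the partition is approximated by uniformly separated
    sets.  Everything is averaged over the measure, so no ergodic
    decomposition is needed. *)
Require Import Defs.
From mathcomp Require Import all_boot all_order all_algebra.
From mathcomp Require Import generic_quotient.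
From mathcomp Require Import all_classical all_reals all_analysis.
From mathcomp Require Import measurable_realfun ring lra zify.

Set Implicit Arguments.
Unset Strict Implicit.
Unset Printing Implicit Defensive.

Import Order.TTheory GRing.Theory Num.Theory.
Import numFieldNormedType.Exports.

Local Open Scope classical_set_scope.
Local Open Scope ring_scope.
Local Open Scope quotient_scope.

(** * Finite codings and entropy *)

Section finite_coding.
Variable R : realType.
Implicit Types x y : R.

(** Entropy is defined here through arbitrary measurable partitions, not through Bowen balls, so a
    code word can predict a letter only while the orbit is in one of the separated sets. The
    reference distribution must therefore be positive on every word: it is smoothed letter by
    letter, and mixed with the uniform law for points that start too high for a bound uniform in
    [n]. The number of balls is bounded by the exponential of a quantity additive along the orbit,
    so that its mean follows from invariance alone.

    The error term is a budget. An entrance into the cusp costs [ln 47] in balls and, with its exit,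
    two switches at [ln (ln M)] each; entrances have frequency at most [1 / (3 ln M)]. Not switching
    costs at most [2 / ln M] per step. The total [(2 + (ln 47 + 2 ln (ln M)) / 3) / ln M] is at most
    [ln (ln M) / ln M] exactly when [ln (ln M) >= 6 + ln 47], which decides the threshold for
    [M]. *)

Lemma gibbs_inequality (I : finType) (p q : I -> R) :
  (forall i, 0 <= p i) -> (forall i, 0 < q i) ->
  \sum_i p i = 1 -> \sum_i q i <= 1 ->
  - (\sum_i p i * ln (p i)) <= \sum_i p i * - ln (q i).
Proof.
move=> p0 q0 p1 q1; rewrite -subr_ge0 opprK -big_split /=.
suff : \sum_i (p i - q i) <= \sum_i (p i * - ln (q i) + p i * ln (p i)).
  by apply: le_trans; rewrite sumrB p1 subr_ge0.
apply: ler_sum => i _; have := p0 i; rewrite le_eqVlt => /predU1P[<-|pi0].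
  by rewrite !mul0r sub0r addr0 oppr_le0 ltW.
have r0 : 0 < q i / p i by rewrite divr_gt0.
have : ln (q i / p i) <= q i / p i - 1.
  by have := @le_ln1Dx R (q i / p i - 1); rewrite addrCA subrr addr0; apply; lra.
have pr : p i * (q i / p i) = q i by rewrite mulrC divfK ?gt_eqF.
move=> /(ler_wpM2l (ltW pi0)); rewrite ln_div ?posrE// [X in _ <= X]mulrBr pr; lra.
Qed.

Lemma ln_prod (I : finType) (F : I -> R) :
  (forall i, 0 < F i) -> ln (\prod_i F i) = \sum_i ln (F i).
Proof.
move=> F0; suff [] : 0 < \prod_i F i /\ ln (\prod_i F i) = \sum_i ln (F i) by [].
apply: (big_rec2 (fun x y => 0 < x /\ ln x = y)) => [|i x y _ [x0 e]].
  by rewrite ltr01 ln1.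
by rewrite mulr_gt0// lnM ?posrE// e.
Qed.

(** The state at time [j - 1], taken to be [false] at time 0: an orbit that starts in the cusp is
    counted as entering it there. Quantifying over the predecessor spares a proof that it is below
    [n]. *)
Definition preceding n (V : {ffun 'I_n -> bool}) (j : nat) : bool :=
  [exists i : 'I_n, (i.+1 == j) && V i].

Definition switches n (V : {ffun 'I_n -> bool}) : {ffun 'I_n -> bool} :=
  [ffun j => V j (+) preceding V j].

Lemma preceding0 n (V : {ffun 'I_n -> bool}) : preceding V 0 = false.
Proof. by apply/existsP => -[i]. Qed.

Lemma precedingS n (V : {ffun 'I_n -> bool}) j (h : (j < n)%N) :
  preceding V j.+1 = V (Ordinal h).
Proof.
apply/existsP/idP => [[i /andP[/eqP[ij]]]|Vj]; last first.
  by exists (Ordinal h); rewrite eqxx.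
by have -> // : Ordinal h = i; apply: val_inj.
Qed.

(** A pattern is the running sum modulo 2 of its switches, since the state before time 0 is
    fixed. *)
Lemma switches_inj n : injective (@switches n).
Proof.
move=> V V' /ffunP e; apply/ffunP => -[j].
elim: j => [|j IH] h; have := e (Ordinal h); rewrite !ffunE /=.
  by rewrite !preceding0 !addbF.
rewrite !(precedingS _ (ltnW h)) IH; exact: addIb.
Qed.

Definition switch_weight (eta : R) (b : bool) := if b then eta else 1 - eta.

(** The law of the letter [w] when the code predicts [b]. The uniform part bounds the cost of a
    wrong prediction by [ln k - ln dlt]. *)
Definition letter_weight k (dlt : R) (b w : 'I_k) :=
  (1 - dlt) * (b == w)%:R + dlt / k%:R.

Lemma sum_letter_weight k dlt (b : 'I_k) : \sum_w letter_weight dlt b w = 1.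
Proof.
rewrite big_split /= -mulr_sumr (bigD1 b)//= eqxx big1 => [|i]; last first.
  by rewrite eq_sym => /negbTE ->.
rewrite sumr_const card_ord addr0 mulr1 -[X in _ + X]mulr_natr divfK ?subrK//.
by rewrite pnatr_eq0 -lt0n (leq_ltn_trans _ (ltn_ord b)).
Qed.

Lemma letter_weight_gt0 k dlt (b w : 'I_k) :
  0 < dlt < 1 -> 0 < letter_weight dlt b w.
Proof.
move=> /andP[d0 d1]; apply: ltr_wpDl; first by rewrite mulr_ge0 ?ler0n ?subr_ge0 ?ltW.
by rewrite divr_gt0 ?ltr0n ?(leq_ltn_trans _ (ltn_ord b)).
Qed.

(** Passing to switches turns the Markov weight into a product of Bernoulli weights. *)
Lemma sum_switch_weight (eta : R) n :
  \sum_(V : {ffun 'I_n -> bool}) \prod_j switch_weight eta (switches V j) = 1.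
Proof.
have -> : \sum_(V : {ffun 'I_n -> bool}) \prod_j switch_weight eta (switches V j) =
    \sum_(s : {ffun 'I_n -> bool}) \prod_j switch_weight eta (s j).
  by rewrite [RHS](reindex_inj (@switches_inj n)).
rewrite -(bigA_distr_bigA (fun (_ : 'I_n) b => switch_weight eta b)) big1// => i _.
by rewrite big_bool /= addrC subrK.
Qed.

(** The law [q] is an even mixture. One half is uniform on words and yields the unconditional bound.
    The other draws a pattern [V], gives each word of [cs V] the weight [1 / beta V] and perturbs
    its letters independently; keeping the single term of [V] and [b] yields the last bound. The
    mass can fall short of 1, as [beta V] only dominates the size of [cs V]. *)
Lemma coding_distribution k n (cs : {ffun 'I_n -> bool} -> seq {ffun 'I_n -> 'I_k})
    (beta : {ffun 'I_n -> bool} -> R) (eta dlt : R) :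
  (0 < k)%N -> 0 < eta < 1 -> 0 < dlt < 1 ->
  (forall V, (size (cs V))%:R <= beta V) -> (forall V, 0 < beta V) ->
  exists q : {ffun 'I_n -> 'I_k} -> R,
    [/\ forall w, 0 < q w, \sum_w q w <= 1,
      forall w, - ln (q w) <= ln 2 + n%:R * ln k%:R &
      forall V b w, b \in cs V -> - ln (q w) <= ln 2 + ln (beta V)
        + \sum_j - ln (switch_weight eta (switches V j))
        + \sum_j - ln (letter_weight dlt (b j) (w j))].
Proof.
move=> k0 /andP[e0 e1] d01 sb b0.
have sw0 b : 0 < switch_weight eta b by case: b => //=; rewrite subr_gt0.
pose A (V : {ffun 'I_n -> bool}) : R := \prod_j switch_weight eta (switches V j).
pose L (b w : {ffun 'I_n -> 'I_k}) : R := \prod_j letter_weight dlt (b j) (w j).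
have A0 (V : {ffun 'I_n -> bool}) : 0 < A V by apply: prodr_gt0.
have L0 b w : 0 < L b w by apply: prodr_gt0 => j _; apply: letter_weight_gt0.
have kn0 : 0 < (k%:R ^+ n : R) by rewrite exprn_gt0// ltr0n.
pose Q w := \sum_V A V / beta V * \sum_(b <- cs V) L b w.
have Qge0 w : 0 <= Q w.
  apply: sumr_ge0 => V _; apply: mulr_ge0; first by rewrite divr_ge0 ?ltW.
  by apply: sumr_ge0 => b _; apply: ltW.
pose q w : R := 2^-1 * (k%:R ^+ n)^-1 + 2^-1 * Q w.
have q1 w : 2^-1 * (k%:R ^+ n)^-1 <= q w by rewrite lerDl mulr_ge0.
have q0 w : 0 < q w by apply: lt_le_trans (q1 w); rewrite mulr_gt0 ?invr_gt0.
exists q; split => //.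
- rewrite big_split /= sumr_const -mulr_sumr card_ffun !card_ord.
  rewrite -[X in X + _]mulr_natr natrX -mulrA mulVf ?gt_eqF// mulr1.
  suff : \sum_w Q w <= 1 by lra.
  rewrite exchange_big /= -(sum_switch_weight eta n); apply: ler_sum => V _.
  rewrite -mulr_sumr exchange_big /= (eq_bigr (fun _ => 1)) => [|b _]; last first.
    rewrite -(bigA_distr_bigA (fun j w => letter_weight dlt (b j) w)) big1// => j _.
    exact: sum_letter_weight.
  rewrite big_const_seq count_predT iter_addr_0 -mulrA ler_piMr ?(ltW (A0 V))//.
  by rewrite ler_pdivrMl// mulr1.
- move=> w; rewrite lerNl.
  have -> : - (ln 2 + n%:R * ln k%:R) = ln (2^-1 * (k%:R ^+ n)^-1 : R).
    rewrite lnM ?posrE ?invr_gt0// !lnV ?posrE// lnXn ?ltr0n// -mulr_natl; lra.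
  by rewrite ler_ln ?posrE// mulr_gt0 ?invr_gt0.
- move=> V b w bV; rewrite lerNl.
  have -> : - (ln 2 + ln (beta V) + \sum_j - ln (switch_weight eta (switches V j))
      + \sum_j - ln (letter_weight dlt (b j) (w j)))
      = ln (2^-1 * (A V / beta V * L b w)).
    rewrite !lnM ?posrE ?invr_gt0 ?mulr_gt0 ?invr_gt0// !lnV ?posrE//.
    rewrite !ln_prod => [|j|j]; rewrite ?letter_weight_gt0//.
    rewrite !sumrN; lra.
  rewrite ler_ln ?posrE ?mulr_gt0 ?invr_gt0//.
  have -> : q w = 2^-1 * Q w + 2^-1 * (k%:R ^+ n)^-1 by rewrite addrC.
  apply: ler_wpDr; first by rewrite mulr_ge0 ?invr_ge0 ?ltW.
  rewrite ler_pM2l ?invr_gt0// /Q (bigD1 V)//= ler_wpDr//.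
    apply: sumr_ge0 => V' _; apply: mulr_ge0; first by rewrite divr_ge0 ?ltW.
    by apply: sumr_ge0 => b' _; apply: ltW.
  rewrite ler_pM2l ?divr_gt0//.
  rewrite (big_rem b)//= lerDl; apply: sumr_ge0 => b' _; exact: ltW.
Qed.

End finite_coding.

(** * Means over a probability measure *)

Section mean.
Context d (T : measurableType d) (R : realType) (mu : probability T R).
Implicit Types (F G : T -> R) (A B : set T).

(** Integrability and value are kept together, so that a pointwise bound written as a sum can be
    averaged term by term. *)
Definition has_mean F (m : R) :=
  mu.-integrable setT (EFin \o F) /\ Rintegral mu setT F = m.

Lemma has_mean_cst c : has_mean (fun=> c) c.
Proof.
split; first exact: finite_measure_integrable_cst.
by rewrite Rintegral_cst// [X in fine X](probability_setT mu) mulr1.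
Qed.

Lemma has_mean_indic A : measurable A -> has_mean \1_A (fine (mu A)).
Proof.
move=> mA; split; first exact: integrable_indic.
by rewrite /Rintegral integral_indic// setIT.
Qed.

Lemma has_meanD F G m m' :
  has_mean F m -> has_mean G m' -> has_mean (fun x => F x + G x) (m + m').
Proof.
move=> [iF <-] [iG <-]; split; last by rewrite RintegralD.
have -> : EFin \o (fun x => F x + G x) = (fun x => (EFin \o F) x + (EFin \o G) x)%E by [].
exact: integrableD.
Qed.

Lemma has_meanZ c F m : has_mean F m -> has_mean (fun x => c * F x) (c * m).
Proof.
move=> [iF <-]; split; last by rewrite RintegralZl.
have -> : EFin \o (fun x => c * F x) = (fun x => c%:E * (EFin \o F) x)%E by [].
exact: integrableZl.
Qed.

Lemma has_mean_sum (I : Type) (s : seq I) (F : I -> T -> R) (m : I -> R) :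
  (forall i, has_mean (F i) (m i)) ->
  has_mean (fun x => \sum_(i <- s) F i x) (\sum_(i <- s) m i).
Proof.
move=> h; elim: s => [|i s IH].
  rewrite big_nil (_ : (fun _ => _) = fun=> 0); last by apply/funext => x; rewrite big_nil.
  exact: has_mean_cst.
rewrite big_cons (_ : (fun _ => _) = fun x => F i x + \sum_(j <- s) F j x).
  exact: has_meanD.
by apply/funext => x; rewrite big_cons.
Qed.

Lemma has_mean_le F G m m' :
  has_mean F m -> has_mean G m' -> (forall x, F x <= G x) -> m <= m'.
Proof. by move=> [iF <-] [iG <-] FG; exact: le_Rintegral. Qed.

End mean.

(** Charges what is observed at time [j] to the transition out of time [j - 1], at the price of one
    initial charge [a]. *)
Lemma sum_shift_le (R : numDomainType) (g : nat -> R) (a : R) n :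
  0 <= a -> (forall j, 0 <= g j) ->
  \sum_(j < n) (if j : nat is i.+1 then g i else a) <= a + \sum_(j < n) g j.
Proof.
move=> a0 g0; case: n => [|n]; first by rewrite !big_ord0 addr0.
by rewrite big_ord_recl/= lerD2l big_ord_recr/= ler_wpDr.
Qed.

(** * The entropy of a partition bounded by a coding of orbits *)

Section entropy_bound.
Context d (T : measurableType d) (R : realType) (mu : probability T R).
Variables (f : T -> T) (mf : measurable_fun setT f) (invf : invariant_measure mu f).
Local Notation Pr A := (fine (mu A)).

Lemma measurable_preimage A : measurable A -> measurable (f @^-1` A).
Proof. by move=> mA; rewrite -[X in measurable X]setTI; exact: mf. Qed.

Lemma measurable_iter_preimage j A : measurable A -> measurable (iter j f @^-1` A).
Proof.
elim: j A => [|j IH] A mA //.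
exact: (IH _ (measurable_preimage mA)).
Qed.

Lemma mu_iter_preimage j A : measurable A -> mu (iter j f @^-1` A) = mu A.
Proof.
elim: j A => [|j IH] A mA //.
exact: etrans (IH _ (measurable_preimage mA)) (invf mA).
Qed.

Definition entering (Y : set T) : set T := ~` Y `&` f @^-1` Y.
Definition leaving (Y : set T) : set T := Y `&` ~` (f @^-1` Y).

(** Each set is [Y] or its preimage, two sets of equal measure, minus their intersection. *)
Lemma mu_entering_leaving Y : measurable Y -> mu (leaving Y) = mu (entering Y).
Proof.
move=> mY; have mfY := measurable_preimage mY.
rewrite /leaving /entering -setDE setIC -setDE !measureD//; last 2 first.
  by rewrite (le_lt_trans (probability_le1 _ _)) ?ltry.
  by rewrite (le_lt_trans (probability_le1 _ _)) ?ltry.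
by congr (_ - _)%E; [exact/esym/invf|rewrite setIC].
Qed.

Variables (k : nat) (P : 'I_k -> set T).
Hypotheses (mP : forall i, measurable (P i)) (partP : partition setT P setT).

Lemma partition_index : exists c : T -> 'I_k, forall x i, P i x <-> c x = i.
Proof.
case: partP => cP tP _.
have ex x : exists i, P i x.
  by have : [set: T] x by []; rewrite -cP => -[i _ Pix]; exists i.
have [c hc] := choice ex; exists c => x i; split=> [Px|<-//].
by apply: (tP _ _ I I); exists x; split.
Qed.

Lemma measurable_dynamical_join n (w : {ffun 'I_n -> 'I_k}) :
  measurable (dynamical_join f P w).
Proof.
apply: fin_bigcap_measurable => // j _.
exact/measurable_iter_preimage.
Qed.

(** By Gibbs' inequality the entropy is at most the mean of [- ln q] at the word of [x], so it
    suffices to bound that quantity along every single orbit. *)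
Lemma shannon_entropy_dynamical_join_le n (q : {ffun 'I_n -> 'I_k} -> R)
    (c : T -> 'I_k) (F : T -> R) m :
  (forall x i, P i x <-> c x = i) ->
  (forall w, 0 < q w) -> \sum_w q w <= 1 ->
  has_mean mu F m -> (forall x, - ln (q [ffun j : 'I_n => c (iter j f x)]) <= F x) ->
  shannon_entropy mu (dynamical_join f P (n := n)) <= m.
Proof.
move=> hc q0 q1 mF qF; rewrite /shannon_entropy.
have joinE w x : (\1_(dynamical_join f P w) x : R) =
    (w == [ffun j : 'I_n => c (iter j f x)])%:R.
  rewrite indicE; congr (nat_of_bool _)%:R; apply/idP/eqP => [/set_mem h|->].
    by apply/ffunP => j; rewrite ffunE; apply/esym/hc/h.
  by apply/mem_set => j _ /=; apply/hc; rewrite ffunE.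
have mj w := has_mean_indic mu (measurable_dynamical_join w).
have sum1 (a : {ffun 'I_n -> 'I_k} -> R) x :
    \sum_w a w * \1_(dynamical_join f P w) x = a [ffun j : 'I_n => c (iter j f x)].
  rewrite (bigD1 [ffun j : 'I_n => c (iter j f x)])//= joinE eqxx mulr1 big1 ?addr0//.
  by move=> w /negbTE wx; rewrite joinE wx mulr0.
have meanS (a : {ffun 'I_n -> 'I_k} -> R) :
    has_mean mu (fun x => a [ffun j : 'I_n => c (iter j f x)])
      (\sum_w a w * Pr (dynamical_join f P w)).
  rewrite (_ : (fun x => _) = fun x => \sum_w a w * \1_(dynamical_join f P w) x).
    by apply: has_mean_sum => w; exact: has_meanZ.
  by apply/funext => x; rewrite sum1.
apply: (@le_trans _ _ (\sum_w Pr (dynamical_join f P w) * - ln (q w))).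
  apply: gibbs_inequality => //.
  have [_ e1] := meanS (fun=> 1); have [_ e2] := has_mean_cst mu (1 : R).
  by rewrite -e2 e1; apply: eq_bigr => w _; rewrite mul1r.
under eq_bigr do rewrite mulrC.
exact: (has_mean_le (meanS (fun w => - ln (q w))) mF).
Qed.

Variables (K : 'I_k -> set T) (Y G : set T) (c C eta dlt : R).
Hypotheses (mK : forall i, measurable (K i)) (KP : forall i, K i `<=` P i).
Hypotheses (mY : measurable Y) (mG : measurable G).
Hypotheses (c0 : 0 <= c) (C0 : 0 <= C) (eta01 : 0 < eta < 1) (dlt01 : 0 < dlt < 1).

Definition visits n (V : {ffun 'I_n -> bool}) : R := \sum_j (V j)%:R.
Definition entrances n (V : {ffun 'I_n -> bool}) : R :=
  \sum_j (V j && ~~ preceding V j)%:R.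

Hypothesis coding : forall n (V : {ffun 'I_n -> bool}),
  exists2 cs : seq {ffun 'I_n -> 'I_k},
    (size cs)%:R <= expR (C + n%:R - visits V / 2 + c * entrances V) &
    forall x, G x -> (forall j : 'I_n, V j = (iter j f x \in Y)) ->
      exists2 b, b \in cs & forall (j : 'I_n) i, K i (iter j f x) -> b j = i.

(** The costs of the coding are collected along each orbit and averaged by invariance. Outside [G]
    whole words are paid at the uniform rate; outside the sets [K i], single letters are. Every
    entrance pays [c - ln eta] and every exit [- ln eta]; exits being as frequent as entrances, this
    makes [c - 2 * ln eta]. The constant [D] contains the charge at time 0, which no transition
    precedes. *)
Lemma entropy_bound_from_coding : exists D : R, forall n,
  shannon_entropy mu (dynamical_join f P (n := n)) <=
  D + n%:R * (1 - Pr Y / 2 - ln (1 - eta) - ln (1 - dlt)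
    + (c - 2 * ln eta) * Pr (entering Y)
    + (ln k%:R - ln dlt) * Pr (~` \bigcup_i K i) + ln k%:R * Pr (~` G)).
Proof.
have [idx hidx] := partition_index.
have k0 : (0 < k)%N by rewrite (leq_ltn_trans _ (ltn_ord (idx point))).
have lnk0 : 0 <= ln (k%:R : R) by rewrite ln_ge0// ler1n.
have [eta0 eta1] := andP eta01; have [dlt0 dlt1] := andP dlt01.
have leta : ln eta <= 0 by rewrite ln_le0 ?ltW.
have leta' : ln (1 - eta) <= 0 by rewrite ln_le0 ?gerBl ?ltW.
have ldlt : ln dlt <= 0 by rewrite ln_le0 ?ltW.
have ldlt' : ln (1 - dlt) <= 0 by rewrite ln_le0 ?gerBl ?ltW.
pose K0 := ~` \bigcup_i K i.
have mK0 : measurable K0 by apply: measurableC; exact: fin_bigcup_measurable.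
have mA : measurable (entering Y).
  by apply: measurableI; [exact: measurableC|exact: measurable_preimage].
have mL : measurable (leaving Y).
  by apply: measurableI => //; apply: measurableC; exact: measurable_preimage.
exists (ln 2 + C + c - ln eta) => n.
(* The cost of one time step. The gain of 1/2 in [Y] is covered by the leading 1, so [phi] is
   nonnegative. *)
pose phi x : R := 1 - ln (1 - eta) - ln (1 - dlt) + (- 2^-1) * \1_Y x
  + (c - ln eta) * \1_(entering Y) x + (- ln eta) * \1_(leaving Y) x
  + (ln k%:R - ln dlt) * \1_K0 x.
have phi0 x : 0 <= phi x.
  rewrite /phi !indicE; do 4 case: (_ \in _); rewrite /= ?mulr1n ?mulr0n; move: c0; lra.
pose F x := ln 2 + C + c - ln eta + \sum_(j < n) phi (iter j f x)
  + (n%:R * ln k%:R) * \1_(~` G) x.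
have meanphi (j : nat) : has_mean mu (phi \o iter j f)
    (1 - ln (1 - eta) - ln (1 - dlt) + (- 2^-1) * Pr Y
  + (c - ln eta) * Pr (entering Y) + (- ln eta) * Pr (leaving Y)
  + (ln k%:R - ln dlt) * Pr K0).
  have mi A : measurable A -> has_mean mu (\1_A \o iter j f) (Pr A).
    move=> mA'; rewrite -(mu_iter_preimage j mA') -[_ \o _]/(\1_(iter j f @^-1` A)).
    exact/has_mean_indic/measurable_iter_preimage.
  do 4 (apply: has_meanD; last exact/has_meanZ/mi).
  exact: has_mean_cst.
have meanF := has_meanD (has_meanD (has_mean_cst mu (ln 2 + C + c - ln eta))
   (has_mean_sum (index_enum 'I_n) meanphi))
   (has_meanZ (n%:R * ln k%:R) (has_mean_indic mu (measurableC mG))).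
pose cs V := sval (cid2 (coding (n := n) V)).
pose beta V := expR (C + n%:R - visits V / 2 + c * entrances (n := n) V).
have [q [q0 q1 qk qc]] : exists q : {ffun 'I_n -> 'I_k} -> R,
    [/\ forall w, 0 < q w, \sum_w q w <= 1,
      forall w, - ln (q w) <= ln 2 + n%:R * ln k%:R &
      forall V b w, b \in cs V -> - ln (q w) <= ln 2 + ln (beta V)
        + \sum_j - ln (switch_weight eta (switches V j))
        + \sum_j - ln (letter_weight dlt (b j) (w j))].
  apply: coding_distribution => // V; last exact: expR_gt0.
  by rewrite /cs; case: cid2.
apply: (le_trans (shannon_entropy_dynamical_join_le hidx q0 q1 meanF _)); last first.
  rewrite mu_entering_leaving// sumr_const card_ord.
  rewrite -[_ *+ n]mulr_natl /K0; lra.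
(* Outside [G] the uniform half of [q] is used; its cost [n ln k] is the last term of [F]. *)
move=> x /=; have [Gx|nGx] := pselect (G x); last first.
  rewrite [\1_(~` G) x]indicE (mem_set (nGx : (~` G) x)) mulr1.
  apply: le_trans (qk _) _; rewrite lerD2r.
  have : 0 <= \sum_(j < n) phi (iter j f x) by apply: sumr_ge0.
  by move: C0 c0 leta; lra.
rewrite [\1_(~` G) x]indicE memNset ?mulr0 ?addr0; last by move=> /(_ Gx).
pose V := [ffun j : 'I_n => iter j f x \in Y].
have [b bV bK] : exists2 b, b \in cs V &
    forall (j : 'I_n) i, K i (iter j f x) -> b j = i.
  by rewrite /cs; case: cid2 => s _ /= h; apply: h => // j; rewrite ffunE.
apply: le_trans (qc _ _ _ bV) _; rewrite /beta expRK.
pose u j := iter j f x \in Y.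
have Vj (j : 'I_n) : V j = u j by rewrite ffunE.
have prec (j : nat) (jn : (j < n)%N) :
    preceding V j = if j is i.+1 then u i else false.
  case: j jn => [|i] jn; first exact: preceding0.
  by rewrite (precedingS _ (ltnW jn)) Vj.
have EE j : \1_(entering Y) (iter j f x) = (~~ u j && u j.+1)%:R :> R.
  by rewrite indicE /entering in_setI in_setC.
have LE j : \1_(leaving Y) (iter j f x) = (u j && ~~ u j.+1)%:R :> R.
  by rewrite indicE /leaving in_setI in_setC.
(* The state before time 0 is [false], so at time 0 an entrance is possible and an exit is not: the
   initial charges are 1 and 0. *)
pose pE (j : nat) : R := if j is i.+1 then \1_(entering Y) (iter i f x) else 1.
pose pL (j : nat) : R := if j is i.+1 then \1_(leaving Y) (iter i f x) else 0.
have ind0 (A : set T) y : 0 <= \1_A y :> R by rewrite indicE ler0n.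
have sE : \sum_(j < n) pE j <= 1 + \sum_(j < n) \1_(entering Y) (iter j f x).
  by apply: (sum_shift_le (g := fun j => \1_(entering Y) (iter j f x))).
have sL : \sum_(j < n) pL j <= 0 + \sum_(j < n) \1_(leaving Y) (iter j f x).
  by apply: (sum_shift_le (g := fun j => \1_(leaving Y) (iter j f x))).
have entE (j : 'I_n) : (V j && ~~ preceding V j)%:R <= pE j.
  rewrite prec// Vj /pE; case: (j : nat) => [|i]; first by rewrite lern1 leq_b1.
  by rewrite EE andbC.
have swE (j : 'I_n) : - ln (switch_weight eta (switches V j)) <=
    - ln (1 - eta) - ln eta * pE j - ln eta * pL j.
  rewrite ffunE prec// Vj /pE /pL; case: (j : nat) => [|i].
    by rewrite addbF /switch_weight; case: ifP => _; lra.
  rewrite EE LE; case: (u i.+1); case: (u i); rewrite /= ?mulr1n ?mulr0n; lra.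
have lwE (j : 'I_n) : - ln (letter_weight dlt (b j) (idx (iter j f x))) <=
    - ln (1 - dlt) + (ln k%:R - ln dlt) * \1_K0 (iter j f x).
  have kR : 0 < k%:R :> R by rewrite ltr0n.
  have dk0 : 0 < dlt / k%:R by rewrite divr_gt0.
  rewrite indicE; have [[i _ Ki]|nK] := pselect ((\bigcup_i K i) (iter j f x)).
    rewrite memNset ?mulr0 ?addr0; last by apply; exists i.
    rewrite (bK _ _ Ki) ((hidx _ _).1 (KP Ki)) /letter_weight eqxx mulr1.
    have h : 1 - dlt <= 1 - dlt + dlt / k%:R by rewrite lerDl ltW.
    rewrite lerN2 ler_ln// posrE ?subr_gt0//.
    by apply: lt_le_trans h; rewrite subr_gt0.
  rewrite mem_set// mulr1 -subr_ge0.
  suff : ln dlt - ln k%:R <= ln (letter_weight dlt (b j) (idx (iter j f x))) by lra.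
  rewrite -ln_div ?posrE// ler_ln ?posrE ?letter_weight_gt0//.
  by rewrite /letter_weight lerDr mulr_ge0 ?subr_ge0// ltW.
have sum1 : \sum_(j < n) (1 : R) = n%:R by rewrite sumr_const card_ord.
rewrite -sum1 /visits /entrances mulr_suml mulr_sumr.
have le1 : \sum_j c * (V j && ~~ preceding V j)%:R <= c * \sum_(j < n) pE j.
  by rewrite mulr_sumr; apply: ler_sum => j _; rewrite ler_wpM2l.
have le2 : \sum_j - ln (switch_weight eta (switches V j)) <=
    \sum_(j < n) (- ln (1 - eta)) + (- ln eta) * \sum_(j < n) pE j
      + (- ln eta) * \sum_(j < n) pL j.
  rewrite !mulr_sumr -!big_split /=; apply: ler_sum => j _.
  by apply: le_trans (swE j) _; rewrite !mulNr.
have le3 : \sum_j - ln (letter_weight dlt (b j) ([ffun j : 'I_n => idx (iter j f x)] j)) <=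
    \sum_(j < n) (- ln (1 - dlt) + (ln k%:R - ln dlt) * \1_K0 (iter j f x)).
  by apply: ler_sum => j _; rewrite ffunE.
have phiE : \sum_(j < n) phi (iter j f x) = \sum_(j < n) 1
    + \sum_(j < n) (- ln (1 - eta))
    + \sum_(j < n) (- ln (1 - dlt) + (ln k%:R - ln dlt) * \1_K0 (iter j f x))
    - \sum_(j < n) (V j)%:R / 2
    + (c - ln eta) * \sum_(j < n) \1_(entering Y) (iter j f x)
    + (- ln eta) * \sum_(j < n) \1_(leaving Y) (iter j f x).
  rewrite !mulr_sumr -sumrN -!big_split /=; apply: eq_bigr => j _.
  rewrite /phi [\1_Y _]indicE -/(u j) Vj; ring.
rewrite phiE; move: le1 le2 le3 sE sL c0 leta; clear.
set a1 := \sum_j c * _; set a2 := \sum_j - ln (switch_weight _ _).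
set a3 := \sum_j - ln (letter_weight _ _ _); set s1 := \sum_(j < n) pE j.
set s2 := \sum_(j < n) pL j; set s3 : R := \sum_(j < n) \1_(entering Y) _.
set s4 : R := \sum_(j < n) \1_(leaving Y) _; set s5 := \sum_(j < n) - ln (1 - eta).
set s6 := \sum_(j < n) (- ln _ + _ * _); set s7 := \sum_(j < n) _ / 2.
move=> le1 le2 le3 sE sL c0 leta; rewrite add0r in sL.
have le4 : (c - ln eta) * s1 <= (c - ln eta) * (1 + s3) by apply: ler_wpM2l => //; rewrite ?subr_ge0 ?oppr_ge0 ?(le_trans leta).
have le5 : (- ln eta) * s2 <= (- ln eta) * s4 by apply: ler_wpM2l => //; rewrite ?subr_ge0 ?oppr_ge0 ?(le_trans leta).
lra.
Qed.

End entropy_bound.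

(** * Excursions of a unipotent orbit *)

Section covering_numbers.
Variables (R : realType) (r : R).

(** A bound on the covering number at the fixed scale [r]; [beta] is real because the bounds are
    products of exponentials. *)
Definition covered (A : set R) (beta : R) :=
  exists2 cs : seq R, (size cs)%:R <= beta &
    forall rho, A rho -> exists2 c, c \in cs & `|rho - c| <= r.

Lemma coveredW A B beta beta' :
  A `<=` B -> beta <= beta' -> covered B beta -> covered A beta'.
Proof.
move=> AB bb [cs sb h]; exists cs; first exact: le_trans bb.
by move=> rho /AB /h.
Qed.

Lemma coveredU A B beta beta' :
  covered A beta -> covered B beta' -> covered (A `|` B) (beta + beta').
Proof.
move=> [s ss hs] [s' ss' hs']; exists (s ++ s').
  by rewrite size_cat natrD lerD.
move=> rho [/hs|/hs'] [c cs cr]; exists c => //; rewrite mem_cat cs ?orbT//.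
Qed.

Definition interval_set (x l : R) : set R := [set rho | x <= rho <= x + l].

Lemma covered_split A lam beta x l : 0 < lam -> 0 <= beta -> 0 <= l ->
  (forall y, covered (A `&` interval_set y lam) beta) ->
  covered (A `&` interval_set x l) ((l / lam + 1) * beta).
Proof.
move=> lam0 beta0 l0 h.
have [k /andP[kl lk]] : exists k : nat, k%:R <= l / lam < k.+1%:R.
  exists (Num.trunc (l / lam)); apply: truncn_itv; exact: divr_ge0 l0 (ltW lam0).
have step k' : covered (A `&` interval_set x (k'.+1%:R * lam)) (k'.+1%:R * beta).
  elim: k' => [|j IH].
    by rewrite !mul1r; exact: h.
  rewrite -[j.+2%:R]natr1 !mulrDl !mul1r.
  apply: coveredW (coveredU IH (h (x + j.+1%:R * lam))) => // rho [Ar].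
  move=> /andP[xr] rx.
  by have [?|?] := leP rho (x + j.+1%:R * lam); [left|right]; split => //; apply/andP; split; lra.
apply: coveredW (step k) => [rho [Ar /andP[xr rx]]|].
  split => //; apply/andP; split => //; apply: le_trans rx _; rewrite lerD2l.
  by rewrite -ler_pdivrMr// ltW.
by rewrite ler_wpM2r// -natr1 lerD2r.
Qed.

End covering_numbers.

Section excursions.
Variable R : realType.
Implicit Types (v w u : R * R) (rho x l : R) (j s n : nat).

Definition cross v w : R := v.1 * w.2 - v.2 * w.1.

(** The squared norm of the row vector [v] after the lower unipotent shear by [rho] and [j] steps of
    the flow, which scale the coordinates by [exp (j / 2)] and [exp (- j / 2)]. *)
Definition flow_sqnorm j rho v : R :=
  expR j%:R * (v.1 + rho * v.2) ^+ 2 + expR (- j%:R) * v.2 ^+ 2.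

Lemma cross_trans v w u : 0 < w.1 ^+ 2 + w.2 ^+ 2 ->
  cross v w = 0 -> cross w u = 0 -> cross v u = 0.
Proof.
case: v w u => [a b] [c d] [e f]; rewrite /cross /= => cd vw wu.
have h1 : c * (a * f - b * e) = 0.
  have -> : c * (a * f - b * e) = a * (c * f - d * e) + e * (a * d - b * c) by ring.
  by rewrite vw wu; ring.
have h2 : d * (a * f - b * e) = 0.
  have -> : d * (a * f - b * e) = b * (c * f - d * e) + f * (a * d - b * c) by ring.
  by rewrite vw wu; ring.
have [//|nz] := eqVneq (a * f - b * e) 0.
move: h1 h2 => /eqP; rewrite mulf_eq0 (negbTE nz) orbF => /eqP c0.
move=> /eqP; rewrite mulf_eq0 (negbTE nz) orbF => /eqP d0.
by move: cd; rewrite c0 d0 expr0n /= addr0 ltxx.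
Qed.

Lemma crossC v w : cross v w = - cross w v.
Proof. by rewrite /cross; ring. Qed.

(* Lagrange's identity; the flow and the shear preserve [cross]. *)
Lemma sqr_cross_le j rho v w :
  cross v w ^+ 2 <= flow_sqnorm j rho v * flow_sqnorm j rho w.
Proof.
rewrite /flow_sqnorm /cross; have := expRxMexpNx_1 (j%:R : R).
set E := expR _; set E' := expR _ => EE.
set p := v.1 + _; set p' := w.1 + _.
have -> : v.1 * w.2 - v.2 * w.1 = p * w.2 - v.2 * p' by rewrite /p /p'; ring.
rewrite -subr_ge0 (_ : _ - _ = (E * p * p' + E' * v.2 * w.2) ^+ 2) ?sqr_ge0//.
have -> : (E * p ^+ 2 + E' * v.2 ^+ 2) * (E * p' ^+ 2 + E' * w.2 ^+ 2) =
  E ^+ 2 * p ^+ 2 * p' ^+ 2 + E' ^+ 2 * v.2 ^+ 2 * w.2 ^+ 2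
  + (E * E') * (p ^+ 2 * w.2 ^+ 2 + v.2 ^+ 2 * p' ^+ 2) by ring.
rewrite EE; have -> : (E * p * p' + E' * v.2 * w.2) ^+ 2 =
  E ^+ 2 * p ^+ 2 * p' ^+ 2 + E' ^+ 2 * v.2 ^+ 2 * w.2 ^+ 2
  + (E * E') * 2 * (p * w.2 * v.2 * p') by ring.
by rewrite EE; ring.
Qed.

Lemma flow_sqnorm_ge0 j rho v : 0 <= flow_sqnorm j rho v.
Proof. by apply: addr_ge0; apply: mulr_ge0; rewrite ?expR_ge0 ?sqr_ge0. Qed.

Lemma flow_sqnormS j rho v :
  flow_sqnorm j.+1 rho v <= expR 1 * flow_sqnorm j rho v /\
  flow_sqnorm j rho v <= expR 1 * flow_sqnorm j.+1 rho v.
Proof.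
rewrite /flow_sqnorm -natr1 opprD !expRD.
have e1 : 1 <= expR 1 :> R by have := expR_ge1Dx (1 : R); lra.
have := expRxMexpNx_1 (1 : R); move: e1; set e := expR 1; set e' := expR (-1) => e1 ee.
have e'0 : 0 < e' by rewrite expR_gt0.
have e'1 : e' <= 1 by rewrite -ee ler_peMl// ltW.
have a0 : 0 <= expR j%:R * (v.1 + rho * v.2) ^+ 2 by rewrite mulr_ge0 ?expR_ge0 ?sqr_ge0.
have b0 : 0 <= expR (- j%:R) * v.2 ^+ 2 by rewrite mulr_ge0 ?expR_ge0 ?sqr_ge0.
move: a0 b0; set X := (_ + _) ^+ 2; set Y := v.2 ^+ 2.
set E := expR _; set E' := expR _ => a0 b0.
split.
  rewrite mulrDr; apply: lerD; first by rewrite (mulrC E) mulrA.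
  rewrite mulrAC [X in _ <= X]mulrC ler_wpM2l//; lra.
rewrite mulrDr; apply: lerD; last first.
  by rewrite (_ : e * _ = (e * e') * (E' * Y)); [rewrite ee mul1r|ring].
rewrite (_ : e * _ = (e * e) * (E * X)); last by ring.
rewrite ler_peMl//; nra.
Qed.

End excursions.

(** * Counting the unipotent parameters that follow a given pattern *)

Section excursion_counting.
Variable R : realType.
Implicit Types (v w : R * R) (rho x : R) (j s k : nat).
Variables (L : set (R * R)) (V : nat -> bool) (n : nat) (t h0 r : R).
Hypotheses (L_neq0 : forall v, L v -> 0 < v.1 ^+ 2 + v.2 ^+ 2)
  (L_cross : forall v w, L v -> L w -> cross v w != 0 -> 1 <= cross v w ^+ 2)
  (t0 : 0 < t) (t_le : t <= 4^-1) (h00 : 0 < h0) (r0 : 0 < r).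

Lemma expR_half_le2 : expR 2^-1 <= 2 :> R.
Proof.
have := expR_ge1Dx (- 2^-1 : R); rewrite expRN => h.
by rewrite -[leRHS]invrK -lef_pV2 ?posrE ?invr_gt0 ?expR_gt0//; lra.
Qed.

Lemma expR1_le4 : expR 1 <= 4 :> R.
Proof.
have -> : (1 : R) = 2^-1 + 2^-1 by lra.
have := expR_half_le2; have := expR_gt0 (2^-1 : R).
rewrite expRD; nra.
Qed.

(** The parameters compatible with the pattern [V], with room for error: [t] will be [4 * M ^- 2],
    so that [t] and [t / 16] lie a factor 4 above and below [M ^- 2], and [h0] will come from a
    height bound at time 0. *)
Definition pattern_set : set R := [set rho | [/\
  forall v, L v -> h0 <= flow_sqnorm 0 rho v,
  forall j, (j < n)%N -> V j -> exists2 v, L v & flow_sqnorm j rho v <= t &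
  forall j, (j < n)%N -> ~~ V j -> forall v, L v -> t / 16 <= flow_sqnorm j rho v]].

(** A nonzero [cross] has absolute value at least 1, which Lagrange's identity forbids for two
    vectors this short. *)
Lemma short_parallel j rho v w : L v -> L w ->
  flow_sqnorm j rho v * flow_sqnorm j rho w < 1 -> cross v w = 0.
Proof.
move=> Lv Lw lt1; apply/eqP; apply: contraT => /(L_cross Lv Lw).
by move=> /le_trans /(_ (sqr_cross_le j rho v w)); rewrite leNgt lt1.
Qed.

(** A vector short at time [s + k + 1] has squared norm at most [expR 1 * t] one step earlier, and
    [expR 1 * t ^+ 2 < 1] makes it parallel to the vector that is short then. Vectors are followed
    up to parallelism, as those of [L] need not be primitive. *)
Lemma run_same_vector rho s k : pattern_set rho -> (s + k < n)%N ->
  (forall j, (s <= j <= s + k)%N -> V j) ->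
  exists v w, [/\ L v, L w, cross v w = 0,
    flow_sqnorm s rho v <= t & flow_sqnorm (s + k) rho w <= t].
Proof.
move=> [_ short _]; elim: k => [|k IH] skn Vs.
  rewrite addn0 in skn *; have [||v Lv vt] := short s => //.
    by apply: Vs; lia.
  by exists v, v; split=> //; rewrite /cross mulrC subrr.
have [||v [w [Lv Lw vw vt wt]]] := IH.
- by lia.
- by move=> j /andP[sj jk]; apply: Vs; lia.
have [||u Lu ut] := short (s + k.+1)%N => //.
  by apply: Vs; lia.
exists v, u; split => //; apply: (cross_trans (L_neq0 Lw)) => //.
apply: (@short_parallel (s + k) rho) => //.
have [_] := flow_sqnormS (s + k) rho u; rewrite -addnS.
have := flow_sqnorm_ge0 (s + k) rho w; have := flow_sqnorm_ge0 (s + k) rho u.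
have := expR1_le4; have := expR_gt0 (1 : R).
move: ut wt t_le t0; nra.
Qed.

(** At time [j] such a shift moves the expanded coordinate by at most the size of the contracted
    one; then [(p + q)^2 <= 2 p^2 + 2 q^2]. *)
Lemma flow_sqnorm_shift j rho rho' v : `|rho - rho'| <= expR (- j%:R) ->
  flow_sqnorm j rho' v <= 3 * flow_sqnorm j rho v.
Proof.
rewrite /flow_sqnorm; have := expRxMexpNx_1 (j%:R : R).
have := expR_gt0 (j%:R : R); have := expR_gt0 (- j%:R : R).
set E := expR j%:R; set E' := expR _ => E'0 E0 EE dr.
set p := v.1 + rho * v.2; set p' := v.1 + rho' * v.2.
have pp : p' = p + (rho' - rho) * v.2 by rewrite /p /p'; ring.
have d2 : (rho' - rho) ^+ 2 <= E' ^+ 2.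
  by rewrite -(real_normK (num_real _)) distrC lerXn2r// nnegrE ltW.
have : p' ^+ 2 <= 2 * p ^+ 2 + 2 * E' ^+ 2 * v.2 ^+ 2.
  have h1 : (rho' - rho) ^+ 2 * v.2 ^+ 2 <= E' ^+ 2 * v.2 ^+ 2.
    by rewrite ler_wpM2r ?sqr_ge0.
  have h2 := sqr_ge0 (p - (rho' - rho) * v.2).
  rewrite pp; move: h1 h2; set X := (rho' - rho); nra.
move=> /(ler_wpM2l (ltW E0)).
have -> : E * (2 * p ^+ 2 + 2 * E' ^+ 2 * v.2 ^+ 2) =
  2 * (E * p ^+ 2) + 2 * ((E * E') * E' * v.2 ^+ 2) by ring.
rewrite EE mul1r.
have : 0 <= E * p ^+ 2 by rewrite mulr_ge0 ?sqr_ge0 ?ltW.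
have : 0 <= E' * v.2 ^+ 2 by rewrite mulr_ge0 ?sqr_ge0 ?ltW.
lra.
Qed.

(* Throughout an excursion all short vectors lie on one line, whose slope
   pins down [rho]: this is where half of the entropy is lost. *)
Lemma run_interval s k Th h x : (s + k < n)%N ->
  (forall j, (s <= j <= s + k)%N -> V j) ->
  0 < h -> (forall rho v, pattern_set rho -> L v -> h <= flow_sqnorm s rho v) ->
  8 * t <= Th ^+ 2 * h -> 0 <= Th ->
  exists y, pattern_set `&` interval_set x (expR (- s%:R)) `<=`
    interval_set y (Th * expR (- s%:R - k%:R / 2)).
Proof.
move=> skn Vs h_gt0 hs tTh Th0.
set E := expR (- s%:R); set K := expR (- (k%:R / 2) : R).
have EK : expR (- s%:R - k%:R / 2) = E * K by rewrite expRD.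
have E0 : 0 < E := expR_gt0 _; have K0 : 0 < K := expR_gt0 _.
rewrite EK.
(* If [Th * K >= 1], the target interval is at least as long as the given one. *)
have [big|small] := leP 1 (Th * K).
  exists x => rho [_ /andP[xr rx]]; apply/andP; split => //.
  by apply: le_trans rx _; rewrite lerD2l mulrCA ler_peMr// ltW.
have tK : t * K ^+ 2 <= h / 8.
  have : (Th * K) ^+ 2 < 1 by rewrite expr_lt1// mulr_ge0// ltW.
  move: (ler_wpM2r (sqr_ge0 K) tTh); nra.
(* At the end of the run [v] is short, although the contribution of its first coordinate to the
   squared norm has grown by [exp k] since time [s]. At time [s] that contribution is thus at most
   [h / 8], which leaves at least [h / 2] to the second coordinate; dividing bounds the distance
   from [rho] to [- v.1 / v.2]. The 8 of the hypothesis is 2 from this [h / 2] times 4 from the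
   half-length [Th / 2]. *)
have key rho v : pattern_set rho -> L v -> flow_sqnorm (s + k) rho v <= t ->
    0 < v.2 ^+ 2 /\ `|rho + v.1 / v.2| <= Th / 2 * (E * K).
  move=> Rr Lv; have := hs _ _ Rr Lv; rewrite /flow_sqnorm.
  have Kk : expR (- k%:R) = K ^+ 2.
    by rewrite /K expr2 -expRD; congr expR; lra.
  have EE := expRxMexpNx_1 (s%:R : R); have KK := expRxMexpNx_1 (k%:R : R).
  rewrite natrD opprD !expRD -/E in EE *; rewrite Kk in KK *.
  move: (expR_gt0 (s%:R : R)) (expR_gt0 (k%:R : R)) EE KK.
  set F := expR s%:R; set G := expR k%:R => F0 G0 EE KK h1 h2.
  set p := v.1 + rho * v.2 in h1 h2.
  have z0 : 0 <= E * K ^+ 2 * v.2 ^+ 2 by do 2 apply: mulr_ge0 (sqr_ge0 _); exact: ltW.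
  have {h2 z0} h2 : F * G * p ^+ 2 <= t by lra.
  have h3 : F * p ^+ 2 <= t * K ^+ 2.
    have := ler_wpM2r (sqr_ge0 K) h2.
    by rewrite (_ : F * G * p ^+ 2 * K ^+ 2 = F * p ^+ 2 * (G * K ^+ 2)); [rewrite KK mulr1|ring].
  have h4 : h / 2 <= E * v.2 ^+ 2 by lra.
  have v20 : 0 < v.2 ^+ 2.
    by rewrite -(pmulr_rgt0 _ E0); lra.
  split => //.
  have vn0 : v.2 != 0 by apply: contraTneq v20 => ->; rewrite expr0n ltxx.
  have nn : 0 <= Th / 2 * (E * K).
    by apply: mulr_ge0; [lra|exact: mulr_ge0 (ltW E0) (ltW K0)].
  rewrite -ler_sqr ?nnegrE//.
  rewrite (real_normK (num_real _)); have -> : rho + v.1 / v.2 = p / v.2.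
    by rewrite /p mulrDl mulfK// addrC.
  rewrite expr_div_n ler_pdivrMr//.
  have := ler_wpM2l (ltW E0) h3.
  rewrite (_ : E * (F * _) = (F * E) * p ^+ 2); last by ring.
  rewrite EE mul1r => h5.
  have EK2 : 0 <= E * K ^+ 2 by rewrite mulr_ge0 ?sqr_ge0// ltW.
  have h6 : 8 * t * (E * K ^+ 2) <= Th ^+ 2 * h * (E * K ^+ 2) by rewrite ler_wpM2r.
  have h7 : Th ^+ 2 * (E * K ^+ 2) * (h / 2) <= Th ^+ 2 * (E * K ^+ 2) * (E * v.2 ^+ 2).
    by rewrite ler_wpM2l// mulr_ge0// sqr_ge0.
  rewrite (_ : _ * v.2 ^+ 2 = Th ^+ 2 * (E * K ^+ 2) * (E * v.2 ^+ 2) / 4); last by field.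
  move: h5 h6 h7; rewrite (mulrCA E) -mulrA; lra.
have [[rho0 [Rr0 /andP[x0 x0']]]|none] :=
    pselect (pattern_set `&` interval_set x E !=set0); last first.
  by exists x => rho Rr; exfalso; apply: none; exists rho.
have [v0 [w0 [Lv0 Lw0 vw0 v0t w0t]]] := run_same_vector Rr0 skn Vs.
have [w20 _] := key _ _ Rr0 Lw0 w0t.
exists (- (w0.1 / w0.2) - Th / 2 * (E * K)) => rho [Rr /andP[xr xr']].
have [v [w [Lv Lw vw vt wt]]] := run_same_vector Rr skn Vs.
have [w2 ] := key _ _ Rr Lw wt.
(* Parameters at distance at most [E] see comparable norms at time [s]: [3 * t * t < 1] makes the
   short vectors of [rho] and [rho0] parallel, so they share one slope. *)
have vv0 : cross v v0 = 0.
  apply: (short_parallel Lv Lv0 (j := s) (rho := rho)).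
  have : flow_sqnorm s rho v0 <= 3 * flow_sqnorm s rho0 v0.
    by apply: flow_sqnorm_shift; rewrite ler_norml -/E; lra.
  have := flow_sqnorm_ge0 s rho v0; have := flow_sqnorm_ge0 s rho v.
  move: v0t vt t0 t_le; nra.
have ww0 : cross w w0 = 0.
  apply: (cross_trans (L_neq0 Lv)); first by rewrite crossC vw oppr0.
  exact: (cross_trans (L_neq0 Lv0)).
have -> : w.1 / w.2 = w0.1 / w0.2.
  have w2n : w.2 != 0 by apply: contraTneq w2 => ->; rewrite expr0n ltxx.
  have w02n : w0.2 != 0 by apply: contraTneq w20 => ->; rewrite expr0n ltxx.
  apply/eqP; rewrite eqr_div//; apply/eqP; move: ww0; rewrite /cross; lra.
rewrite ler_norml => /andP[lo hi]; apply/andP; split; lra.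
Qed.

(** After cutting into pieces of length [exp (- s)], each piece shrinks to length
    [Th * exp (- s - k / 2)]. Measured in units of [exp (- (s + k + 1))] this is
    [Th * exp (1 / 2) * exp ((k + 1) / 2)], and [exp (1 / 2) <= 2]: the [k + 1] times of the run
    cost half of the usual exponent. *)
Lemma run_step s k Th h beta : (s + k < n)%N ->
  (forall j, (s <= j <= s + k)%N -> V j) ->
  0 < h -> (forall rho v, pattern_set rho -> L v -> h <= flow_sqnorm s rho v) ->
  8 * t <= Th ^+ 2 * h -> 0 <= Th -> 0 <= beta ->
  (forall x l, 0 <= l -> covered r (pattern_set `&` interval_set x l)
    ((l * expR (s + k).+1%:R + 1) * beta)) ->
  forall x l, 0 <= l -> covered r (pattern_set `&` interval_set x l)
    ((l * expR s%:R + 1) * ((2 * Th + 1) * expR (k.+1%:R / 2) * beta)).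
Proof.
move=> skn Vs h_gt0 hs tTh Th0 beta0 IH x l l0.
rewrite -[expR s%:R]invrK -expRN.
apply: covered_split; rewrite ?expR_gt0 ?mulr_ge0 ?expR_ge0 ?addr_ge0 ?mulr_ge0//.
move=> y; have [z yz] := run_interval y skn Vs h_gt0 hs tTh Th0.
have E0 : 0 <= Th * expR (- s%:R - k%:R / 2) by rewrite mulr_ge0 ?expR_ge0.
apply: coveredW (IH z _ E0) => [rho [Rr ry]|].
  by split => //; apply: yz.
rewrite ler_wpM2r// -mulrA -expRD.
have -> : - s%:R - k%:R / 2 + (s + k).+1%:R = 2^-1 + k.+1%:R / 2 :> R.
  by rewrite -[(s + k).+1%:R]natr1 -[k.+1%:R]natr1 natrD; lra.
have : 1 <= expR (k.+1%:R / 2) :> R by rewrite -expR0 ler_expR divr_ge0.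
have := expR_half_le2; have := expR_gt0 (2^-1 : R).
rewrite expRD; set a := expR 2^-1; set b := expR _ => a0 a2 b1.
have : Th * (a * b) <= Th * (2 * b) by rewrite ler_wpM2l// ler_wpM2r//; lra.
lra.
Qed.

Variables (sg : R).
Hypotheses (sg0 : 0 < sg) (sg1 : sg <= 1) (rE : r = sg * expR (- n%:R)).

Definition previously_visited j := (0 < j)%N && V j.-1.

(* Every excursion costs a bounded factor [47 = 2 * 23 + 1], from [run_step]
   with [Th = 23]. *)
Definition excursion_cost : R := ln 47.

Definition log_count s : R := \sum_(s <= j < n)
  (1 - (V j)%:R / 2 + excursion_cost * (V j && ~~ previously_visited j)%:R).

Lemma excursion_cost_ge0 : 0 <= excursion_cost.
Proof. by rewrite ln_ge0// ler1n. Qed.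

Lemma run_end s : (s < n)%N -> V s ->
  exists k, [/\ (s + k < n)%N, forall j, (s <= j <= s + k)%N -> V j &
    (s + k).+1 = n \/ ~~ V (s + k).+1].
Proof.
have [m] := ubnP (n - s); elim: m s => // m IH s sm sn Vs.
have V0 j : (s <= j <= s)%N -> V j by move=> ?; have -> : j = s by lia.
have [nE|nE] := eqVneq s.+1 n; first by exists 0; rewrite addn0; split=> //; left.
have [Vs1|Vs1] := boolP (V s.+1); last by exists 0; rewrite addn0; split=> //; right.
have [k [skn Vk e]] := IH s.+1 ltac:(lia) ltac:(lia) Vs1.
exists k.+1; rewrite -addSnnS; split => // j /andP[].
by rewrite leq_eqVlt => /predU1P[<-//|sj jk]; apply: Vk; rewrite sj.
Qed.

Lemma log_count_run s k : (s + k < n)%N -> (forall j, (s <= j <= s + k)%N -> V j) ->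
  log_count s = k.+1%:R / 2 + excursion_cost * (~~ previously_visited s)%:R
    + log_count (s + k).+1.
Proof.
move=> skn Vs; rewrite /log_count (big_cat_nat _ (n := (s + k).+1))//=; last lia.
congr (_ + _); elim: k Vs skn => [|k IH] Vs skn.
  by rewrite addn0 big_nat1 Vs ?addn0 ?leqnn//=; lra.
rewrite addnS big_nat_recr /=; last lia.
rewrite IH; [|by move=> j ?; apply: Vs; lia|lia].
have -> : V (s + k).+1 by apply: Vs; lia.
have -> : previously_visited (s + k).+1 by rewrite /previously_visited/=; apply: Vs; lia.
by rewrite -[k.+2%:R]natr1 /= mulr0; lra.
Qed.

(** Backward induction on [s], a whole run being crossed at once. The disjunction keeps [s] from
    falling inside a run, or on a run that starts at time 0: the time before a run is outside the
    cusp, and this is what bounds all vectors from below when the run begins. *)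
Lemma covered_pattern_set s : (s <= n)%N ->
  [|| s == n, ~~ V s | (0 < s)%N && ~~ previously_visited s] ->
  forall x l, 0 <= l -> covered r (pattern_set `&` interval_set x l)
    ((l * expR s%:R + 1) * (sg^-1 * expR (log_count s))).
Proof.
have [m] := ubnP (n - s); elim: m s => // m IH s sm sn.
have nm s' : (s < s' <= n)%N -> (n - s' < m)%N by lia.
move=> hs x l l0.
have sgV : 1 <= sg^-1 by rewrite invf_ge1.
have [sE|nsn] := eqVneq s n.
  have r1 y : covered r (pattern_set `&` interval_set y r) 1.
    exists [:: y] => // rho [_ /andP[y1 y2]]; exists y; rewrite ?mem_head//.
    by rewrite ler_norml; lra.
  have cov := covered_split x r0 ler01 l0 r1.
  apply: coveredW cov => //.
  rewrite /log_count sE big_geq// expR0 !mulr1 rE invfM expRN invrK.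
  by rewrite mulrDl mul1r mulrAC lerD// mulrA mulrAC.
have sltn : (s < n)%N by rewrite ltn_neqAle nsn.
have [Vs|nVs] := boolP (V s); last first.
  have IHs : forall x l, 0 <= l -> covered r (pattern_set `&` interval_set x l)
    ((l * expR s.+1%:R + 1) * (sg^-1 * expR (log_count s.+1))).
    by apply: IH => //; [rewrite nm// ltnSn|rewrite /previously_visited/= nVs !orbT].
  apply: coveredW (IHs x l l0) => //.
  rewrite {2}/log_count big_ltn// -/(log_count s.+1) (negbTE nVs) /= mul0r subr0 mulr0 addr0.
  rewrite expRD (mulrCA sg^-1) [leRHS]mulrA.
  apply: ler_wpM2r; first by rewrite mulr_ge0 ?expR_ge0// invr_ge0 ltW.
  have : 1 <= expR 1 :> R by rewrite -[leLHS](@expR0 R) ler_expR.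
  rewrite -[s.+1%:R]natr1 expRD; lra.
move: hs; rewrite (negbTE nsn) Vs /= => /andP[s0 pV].
have [k [skn Vk e]] := run_end sltn Vs.
have IHk : forall x l, 0 <= l -> covered r (pattern_set `&` interval_set x l)
    ((l * expR (s + k).+1%:R + 1) * (sg^-1 * expR (log_count (s + k).+1))).
  apply: IH => //; first by rewrite nm// skn ltnS leq_addr.
  by case: e => [->|->]; rewrite ?eqxx ?orbT.
(* At time [s - 1] no vector is below [t / 16], and one step divides squared norms by at most
   [expR 1 <= 4]. *)
have low rho v : pattern_set rho -> L v -> t / 64 <= flow_sqnorm s rho v.
  move=> [_ _ long] Lv.
  have nV : ~~ V s.-1 by move: pV; rewrite /previously_visited s0.
  have sn' : (s.-1 < n)%N by rewrite (leq_ltn_trans (leq_pred s)).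
  have := long _ sn' nV _ Lv; have [_] := flow_sqnormS s.-1 rho v; rewrite (prednK s0).
  have := expR1_le4; have := flow_sqnorm_ge0 s rho v; nra.
have t64 : 0 < t / 64 by rewrite divr_gt0.
(* The value 23 comes from [8 * 64 = 512 <= 23 ^ 2]. *)
have t23 : 8 * t <= 23 ^+ 2 * (t / 64) by move: t0; lra.
have B0 : 0 <= sg^-1 * expR (log_count (s + k).+1).
  by rewrite mulr_ge0 ?expR_ge0// invr_ge0 ltW.
apply: coveredW (run_step skn Vk t64 low t23 _ B0 IHk x l0) => //.
rewrite ler_wpM2l ?addr_ge0 ?mulr_ge0 ?expR_ge0// (log_count_run skn Vk) pV mulr1.
rewrite !expRD /excursion_cost lnK ?posrE//.
by rewrite (_ : 2 * 23 + 1 = 47); [lra|lra].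
Qed.

(** The orbit may start in the middle of an excursion; the lower bound on vectors then comes from
    [h0], and [Th] depends on it. This happens once per orbit, so it only affects the constant in
    front. *)
Lemma covered_pattern_set0 Th x l : 8 * t <= Th ^+ 2 * h0 -> 23 <= Th -> 0 <= l ->
  covered r (pattern_set `&` interval_set x l)
    ((l + 1) * ((2 * Th + 1) * sg^-1 * expR (log_count 0))).
Proof.
move=> tTh Th23 l0.
have [h|] := boolP [|| 0%N == n, ~~ V 0%N | (0 < 0)%N && ~~ previously_visited 0].
  apply: coveredW (covered_pattern_set (leq0n n) h x l0) => //.
  rewrite expR0 mulr1 ler_wpM2l ?addr_ge0// -mulrA.
  by apply: ler_peMl; [rewrite mulr_ge0 ?expR_ge0// invr_ge0 ltW|lra].
rewrite /= orbF negb_or negbK => /andP[]; rewrite eq_sym -lt0n => n0 V0.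
have [k [skn Vk e]] := run_end n0 V0.
have IHk : forall x l, 0 <= l -> covered r (pattern_set `&` interval_set x l)
    ((l * expR (0 + k).+1%:R + 1) * (sg^-1 * expR (log_count (0 + k).+1))).
  apply: covered_pattern_set => //.
  by case: e => [->|->]; rewrite ?eqxx ?orbT.
have low rho v : pattern_set rho -> L v -> h0 <= flow_sqnorm 0 rho v.
  by move=> [low _ _]; exact: low.
have B0 : 0 <= sg^-1 * expR (log_count (0 + k).+1).
  by rewrite mulr_ge0 ?expR_ge0// invr_ge0 ltW.
have Th0 : 0 <= Th by lra.
apply: coveredW (run_step skn Vk h00 low tTh Th0 B0 IHk x l0) => //.
rewrite expR0 mulr1 ler_wpM2l ?addr_ge0// (log_count_run skn Vk) /= mulr1.
rewrite !expRD /excursion_cost lnK ?posrE//.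
have : 0 < (2 * Th + 1) * (sg^-1 * (expR (k.+1%:R / 2) * expR (log_count (0 + k).+1))).
  by rewrite !mulr_gt0 ?invr_gt0 ?expR_gt0//; lra.
nra.
Qed.

End excursion_counting.

(** * The group SL2 *)

Section two_by_two.
Variable R : realType.
Implicit Types (g h k : SL2 R) (e : R).

Lemma mulmx2E n p (A : 'M[R]_(n, 2)) (B : 'M[R]_(2, p)) i j : (A *m B) i j = A i 0 * B 0 j + A i 1 * B 1 j.
Proof.
rewrite mxE big_ord_recl big_ord1; congr (_ + _ * _); by [|congr (B _ _); exact: val_inj|
  congr (A _ _); exact: val_inj].
Qed.

Lemma ord2_split (P : 'I_2 -> Prop) : P 0 -> P 1 -> forall i, P i.
Proof.
move=> P0 P1 [[|[|i]] hi] //.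
  by have -> : Ordinal hi = 0 by apply: val_inj.
by have -> : Ordinal hi = 1 by apply: val_inj.
Qed.

Lemma det2E (K : comNzRingType) (A : 'M[K]_2) : \det A = A 0 0 * A 1 1 - A 0 1 * A 1 0.
Proof.
rewrite (expand_det_row _ 0) big_ord_recl big_ord1 /cofactor !det_mx11 !mxE /=.
have -> : lift (0 : 'I_2) 0 = 1 by apply: val_inj.
have -> : lift (1 : 'I_2) 0 = 0 by apply: val_inj.
by rewrite /= expr0 expr1; ring.
Qed.

Lemma SL2_det2 g : g 0 0 * g 1 1 - g 0 1 * g 1 0 = 1.
Proof. by rewrite -det2E det_SL2. Qed.

Lemma SL2P g h : g 0 0 = h 0 0 -> g 0 1 = h 0 1 -> g 1 0 = h 1 0 -> g 1 1 = h 1 1 ->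
  g = h.
Proof.
move=> e00 e01 e10 e11; apply: SL2_inj; apply/matrixP.
by apply: ord2_split; apply: ord2_split.
Qed.

Lemma SL2_mulE g h i j : SL2_mul g h i j = g i 0 * h 0 j + g i 1 * h 1 j.
Proof. exact: mulmx2E. Qed.

Definition mx2 (a b c d : R) : 'M[R]_2 :=
  \matrix_(i, j) if i == 0 then (if j == 0 then a else b) else if j == 0 then c else d.

Lemma det_mx2 a b c d : \det (mx2 a b c d) = a * d - b * c.
Proof. by rewrite det2E !mxE. Qed.

Lemma mkSL2_subproof a b c d : a * d - b * c = 1 -> \det (mx2 a b c d) = 1.
Proof. by rewrite det_mx2. Qed.

Definition SL2_of a b c d (e : a * d - b * c = 1) : SL2 R := mkSL2 (mkSL2_subproof e).

Lemma SL2_ofE a b c d (e : a * d - b * c = 1) :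
  ((SL2_of e 0 0 = a) * (SL2_of e 0 1 = b) * (SL2_of e 1 0 = c) * (SL2_of e 1 1 = d))%type.
Proof. by rewrite !mxE. Qed.

Lemma SL2_inv_subproof g : g 1 1 * g 0 0 - (- g 0 1) * (- g 1 0) = 1.
Proof. by rewrite -(SL2_det2 g); ring. Qed.

Definition SL2_inv g : SL2 R := SL2_of (SL2_inv_subproof g).

Lemma SL2_mulA g h k : SL2_mul g (SL2_mul h k) = SL2_mul (SL2_mul g h) k.
Proof. by apply: SL2_inj; rewrite /= mulmxA. Qed.

Lemma SL2_mulK g h : SL2_mul (SL2_mul g h) (SL2_inv h) = g.
Proof.
have dh := SL2_det2 h.
by apply: SL2P; rewrite !SL2_mulE !SL2_ofE -[RHS]mulr1 -dh; ring.
Qed.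

Lemma SL2_mulKV g h : SL2_mul g (SL2_mul (SL2_inv g) h) = h.
Proof.
have dh := SL2_det2 g.
by apply: SL2P; rewrite !SL2_mulE !SL2_ofE -[RHS]mul1r -dh; ring.
Qed.

Lemma SL2_mul1 g : SL2_mul g (SL2_1 R) = g.
Proof. by apply: SL2_inj; rewrite /= mulmx1. Qed.

(** Neighbourhoods of the identity, used for right translations [SL2_mul g h]: these descend to the
    quotient by [SL2(Z)] on the left, and the flow acts on them by conjugation. The entrywise form
    is preserved by inversion with the same [e]. *)
Definition near1 e h :=
  [/\ `|h 0 0 - 1| < e, `|h 0 1| < e, `|h 1 0| < e & `|h 1 1 - 1| < e].

Lemma near1_inv e h : near1 e h -> near1 e (SL2_inv h).
Proof. by move=> [h1 h2 h3 h4]; split; rewrite SL2_ofE ?normrN. Qed.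

Lemma near1W e e' h : e <= e' -> near1 e h -> near1 e' h.
Proof. by move=> ee [h1 h2 h3 h4]; split; apply: lt_le_trans ee. Qed.

Lemma near1_1 e : 0 < e -> near1 e (SL2_1 R).
Proof. by move=> e0; split; rewrite !mxE/= ?subrr normr0. Qed.

(** Every entry of the product is off by four terms, each smaller than [e], the quadratic ones
    because [e <= 1]. *)
Lemma near1_mul e h k : e <= 1 -> near1 e h -> near1 e k -> near1 (4 * e) (SL2_mul h k).
Proof.
move=> e1 [h1 h2 h3 h4] [k1 k2 k3 k4].
have e0 : 0 < e by apply: le_lt_trans h1.
have M a b : `|a| < e -> `|b| < e -> `|a * b| < e.
  move=> ae be; rewrite normrM; apply: le_lt_trans (_ : `|a| * 1 < _); last by rewrite mulr1.
  by rewrite ler_wpM2l// ltW// (lt_le_trans be).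
split; rewrite SL2_mulE.
- rewrite (_ : _ - 1 = (h 0 0 - 1) * (k 0 0 - 1) + (h 0 0 - 1) + (k 0 0 - 1) + h 0 1 * k 1 0); last by ring.
  have := M _ _ h1 k1; have := M _ _ h2 k3; move: h1 k1; rewrite !ltr_norml; lra.
- rewrite (_ : _ + _ = (h 0 0 - 1) * k 0 1 + k 0 1 + h 0 1 * (k 1 1 - 1) + h 0 1); last by ring.
  have := M _ _ h1 k2; have := M _ _ h2 k4; move: h2 k2; rewrite !ltr_norml; lra.
- rewrite (_ : _ + _ = h 1 0 * (k 0 0 - 1) + h 1 0 + (h 1 1 - 1) * k 1 0 + k 1 0); last by ring.
  have := M _ _ h3 k1; have := M _ _ h4 k3; move: h3 k3; rewrite !ltr_norml; lra.
- rewrite (_ : _ - 1 = h 1 0 * k 0 1 + (h 1 1 - 1) * (k 1 1 - 1) + (h 1 1 - 1) + (k 1 1 - 1)); last by ring.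
  have := M _ _ h3 k2; have := M _ _ h4 k4; move: h4 k4; rewrite !ltr_norml; lra.
Qed.

Definition entry_bound g : R := 1 + `|g 0 0| + `|g 0 1| + `|g 1 0| + `|g 1 1|.

Lemma entry_bound_ge1 g : 1 <= entry_bound g.
Proof. by rewrite /entry_bound; have := normr_ge0; move=> n0; rewrite -!addrA lerDl !addr_ge0. Qed.

Lemma nbhs_SL2 g (A : set (SL2 R)) : nbhs g A <->
  exists2 e, 0 < e & forall g', (forall i j, `|g' i j - g i j| < e) -> A g'.
Proof.
split.
  move=> [U [[W oW WU] Ug UA]].
  have /nbhs_ballP[e /= e0 eW] : nbhs (SL2mx g) W.
    by apply: open_nbhs_nbhs; split => //; rewrite -WU in Ug.
  exists e => // g' g'e; apply: UA; rewrite -WU.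
  apply: eW; split=> // i j; rewrite -ball_normE /ball_/= distrC; exact: g'e.
move=> [e e0 eA].
have nb : nbhs (SL2mx g) (ball (SL2mx g) e) by apply/nbhs_ballP; exists e.
have cont : continuous (@SL2mx R).
  by move=> x; apply: (@initial_continuous (set_type [set g : 'M[R]_2 | \det g = 1]) _ set_val).
have : nbhs g (@SL2mx R @^-1` ball (SL2mx g) e) by exact: cont.
apply: filterS => g' [_ h]; apply: eA => i j.
by have := h i j; rewrite -ball_normE /ball_/= distrC.
Qed.

(** Left multiplication by a matrix, here [g] or its inverse, distorts small entries by at most
    twice its [entry_bound], so the translates of [near1] form a neighbourhood base. *)
Lemma nbhs_SL2_near1 g (A : set (SL2 R)) : nbhs g A <->
  exists2 e, 0 < e & forall h, near1 e h -> A (SL2_mul g h).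
Proof.
have eb g' := entry_bound_ge1 g'.
have e0 g' : 0 < entry_bound g' by have := eb g'; lra.
have n4 (g' : SL2 R) i j : `|g' i j| <= entry_bound g'.
  rewrite /entry_bound.
  have := normr_ge0 (g' 0 0); have := normr_ge0 (g' 0 1); have := normr_ge0 (g' 1 0).
  have := normr_ge0 (g' 1 1) => *.
  by move: i j; apply: ord2_split; apply: ord2_split; lra.
have lem (e : R) (g' : SL2 R) i (a b : R) : `|a| < e / (2 * entry_bound g') ->
    `|b| < e / (2 * entry_bound g') -> `|g' i 0 * a + g' i 1 * b| < e.
  move=> ae be; apply: le_lt_trans (ler_normD _ _) _; rewrite !normrM.
  have : `|g' i 0| * `|a| + `|g' i 1| * `|b| <= entry_bound g' * (`|a| + `|b|).
    by rewrite mulrDr lerD// ler_wpM2r.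
  move=> /le_lt_trans; apply; rewrite -ltr_pdivlMl// mulrC.
  have : e / (2 * entry_bound g') = e / entry_bound g' / 2 by rewrite invfM; lra.
  move: ae be; lra.
rewrite nbhs_SL2; split=> -[e e_gt0 eA].
  exists (e / (2 * entry_bound g)); first by rewrite divr_gt0// mulr_gt0.
  move=> h [h1 h2 h3 h4]; apply: eA => i.
  apply: ord2_split; rewrite SL2_mulE.
    have -> : g i 0 * h 0 0 + g i 1 * h 1 0 - g i 0 = g i 0 * (h 0 0 - 1) + g i 1 * h 1 0 by ring.
    exact: lem.
  have -> : g i 0 * h 0 1 + g i 1 * h 1 1 - g i 1 = g i 0 * h 0 1 + g i 1 * (h 1 1 - 1) by ring.
  exact: lem.
set g1 := SL2_inv g.
exists (e / (2 * entry_bound g1)); first by rewrite divr_gt0// mulr_gt0.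
move=> g' hg'; rewrite -(SL2_mulKV g g'); apply: eA; rewrite -/g1.
have E i j : SL2_mul g1 g' i j = SL2_mul g1 g i j +
    (g1 i 0 * (g' 0 j - g 0 j) + g1 i 1 * (g' 1 j - g 1 j)).
  by rewrite !SL2_mulE; ring.
have dg := SL2_det2 g.
have I00 : SL2_mul g1 g 0 0 = 1 by rewrite SL2_mulE !SL2_ofE -dg; ring.
have I01 : SL2_mul g1 g 0 1 = 0 by rewrite SL2_mulE !SL2_ofE; ring.
have I10 : SL2_mul g1 g 1 0 = 0 by rewrite SL2_mulE !SL2_ofE; ring.
have I11 : SL2_mul g1 g 1 1 = 1 by rewrite SL2_mulE !SL2_ofE -dg; ring.
split; rewrite E ?I00 ?I01 ?I10 ?I11 ?(addrC 1) ?addrK ?add0r; exact: lem.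
Qed.

End two_by_two.

(** * Lattices and their heights *)

Section lattice_vectors.
Variable R : realType.
Local Notation X := (SL2ZSL2R R).
Implicit Types (g h : SL2 R) (e M : R) (m : 'rV[int]_2).

Lemma pi_surj (x : X) : exists g, x = \pi_X g.
Proof. by exists (repr x); rewrite reprK. Qed.

Definition lattice_vec g m : R * R :=
  ((m 0 0)%:~R * g 0 0 + (m 0 1)%:~R * g 1 0, (m 0 0)%:~R * g 0 1 + (m 0 1)%:~R * g 1 1).

Definition nonzero_lattice g : set (R * R) := [set lattice_vec g m | m in [set m | m != 0]].

Definition sqnorm (v : R * R) : R := v.1 ^+ 2 + v.2 ^+ 2.

Lemma sqnorm_ge0 v : 0 <= sqnorm v.
Proof. by rewrite addr_ge0// sqr_ge0. Qed.

Lemma introw_neq0 m : (m != 0) = (m 0 0 != 0) || (m 0 1 != 0).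
Proof.
apply/idP/idP => [|h]; last by apply: contraTneq h => ->; rewrite !mxE eqxx.
apply: contraR; rewrite negb_or !negbK => /andP[/eqP m0 /eqP m1].
apply/eqP/rowP; apply: ord2_split; by rewrite mxE.
Qed.

Lemma cross_lattice_vec g m m' : cross (lattice_vec g m) (lattice_vec g m') =
  (m 0 0 * m' 0 1 - m 0 1 * m' 0 0)%:~R.
Proof.
rewrite /cross /= rmorphB !rmorphM /= -[RHS]mulr1 -(SL2_det2 g); ring.
Qed.

Lemma nonzero_lattice_cross g v w : nonzero_lattice g v -> nonzero_lattice g w ->
  cross v w != 0 -> 1 <= cross v w ^+ 2.
Proof.
move=> [m _ <-] [m' _ <-]; rewrite cross_lattice_vec intr_eq0 -rmorphXn /=.
move=> nz; rewrite (_ : 1 = 1%:~R)// ler_int.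
by have := sqr_ge0 (m 0 0 * m' 0 1 - m 0 1 * m' 0 0); move: nz; nia.
Qed.

Lemma sqr_cross_sqnorm v w : cross v w ^+ 2 <= sqnorm v * sqnorm w.
Proof.
rewrite -subr_ge0 (_ : _ - _ = (v.1 * w.1 + v.2 * w.2) ^+ 2) ?sqr_ge0//.
by rewrite /sqnorm /cross; ring.
Qed.

Definition row_sqnorm g : R := sqnorm (g 0 0, g 0 1) + sqnorm (g 1 0, g 1 1).

(** Each coordinate of [m] is, up to sign, the [cross] of the lattice vector with a row of [g]; so
    vectors of bounded norm have bounded coordinates. *)
Lemma coord_le g m : (m 0 0)%:~R ^+ 2 <= sqnorm (lattice_vec g m) * row_sqnorm g /\
  (m 0 1)%:~R ^+ 2 <= sqnorm (lattice_vec g m) * row_sqnorm g.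
Proof.
have c0 : cross (lattice_vec g m) (g 1 0, g 1 1) = (m 0 0)%:~R.
  by rewrite /cross /= -[RHS]mulr1 -(SL2_det2 g); ring.
have c1 : cross (lattice_vec g m) (g 0 0, g 0 1) = - (m 0 1)%:~R.
  by rewrite /cross /= -[RHS]mulr1 -(SL2_det2 g); ring.
have s0 := sqnorm_ge0 (lattice_vec g m).
split.
  rewrite -c0; apply: le_trans (sqr_cross_sqnorm _ _) _.
  by rewrite ler_wpM2l// lerDr sqnorm_ge0.
rewrite -sqrrN -c1; apply: le_trans (sqr_cross_sqnorm _ _) _.
by rewrite ler_wpM2l// lerDl sqnorm_ge0.
Qed.

Lemma nonzero_lattice_sqnorm_gt0 g v : nonzero_lattice g v -> 0 < sqnorm v.
Proof.
move=> [m m0 <-]; rewrite lt_neqAle sqnorm_ge0 andbT eq_sym; apply: contraNneq m0 => s0.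
have z (x : int) : x%:~R ^+ 2 <= (0 : R) -> x == 0.
  by move=> h; rewrite -(intr_eq0 R) -sqrf_eq0 eq_le h sqr_ge0.
have [] := coord_le g m; rewrite s0 mul0r => /z x0 /z x1.
by apply: contraT; rewrite introw_neq0 x0 x1.
Qed.

(** A vector no longer than the first row of [g] has its coordinates in a finite box, which [dec]
    enumerates; the minimum is taken there. *)
Lemma shortest_vector g : exists2 m, m != 0 &
  forall m', m' != 0 -> sqnorm (lattice_vec g m) <= sqnorm (lattice_vec g m').
Proof.
pose e0 : 'rV[int]_2 := \row_j (j == 0)%:R.
have e0n : e0 != 0 by rewrite introw_neq0 !mxE.
pose q0 := sqnorm (lattice_vec g e0).
have rs0 : 0 <= row_sqnorm g by apply: addr_ge0; exact: sqnorm_ge0.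
have q00 : 0 <= q0 * row_sqnorm g by apply: mulr_ge0 => //; exact: sqnorm_ge0.
have [B hB] : exists B : nat, q0 * row_sqnorm g <= B%:R ^+ 2.
  have [B hB] : exists B : nat, q0 * row_sqnorm g < B.+1%:R.
    by have /andP[_ h] := truncn_itv q00; eexists; exact: h.
  by exists B.+1; apply: (le_trans (ltW hB)); rewrite expr2 ler_peMl// ler1n.
pose dec (p : 'I_(B.*2.+1) * 'I_(B.*2.+1)) : 'rV[int]_2 :=
  \row_j (if j == 0 then (p.1 : nat)%:Z - B%:Z else (p.2 : nat)%:Z - B%:Z).
have box m : sqnorm (lattice_vec g m) <= q0 -> exists p, dec p = m.
  move=> mq.
  have small i : (m 0 i)%:~R ^+ 2 <= (B%:R ^+ 2 : R) -> (`|m 0%R i| <= B)%N.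
    move=> h; have : ((m 0 i) ^+ 2)%:~R <= ((B%:Z) ^+ 2)%:~R :> R by rewrite !rmorphXn.
    rewrite ler_int; nia.
  have [c0 c1] := coord_le g m.
  have mono : sqnorm (lattice_vec g m) * row_sqnorm g <= B%:R ^+ 2.
    by apply: le_trans hB; rewrite ler_wpM2r.
  have s0 := small _ (le_trans c0 mono); have s1 := small _ (le_trans c1 mono).
  have l0 : (`|(m 0 0 + B%:Z)%R| < B.*2.+1)%N by lia.
  have l1 : (`|(m 0 1 + B%:Z)%R| < B.*2.+1)%N by lia.
  exists (Ordinal l0, Ordinal l1); apply/rowP; apply: ord2_split; rewrite mxE /=; lia.
have [p0 hp0] := box _ (lexx q0).
have P0 : dec p0 != 0 by rewrite hp0.
have [p Pp pmin] := @Order.TotalTheory.arg_minP _ _ _ p0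
  (fun p => dec p != 0) (fun p => sqnorm (lattice_vec g (dec p))) P0.
exists (dec p) => // m' m'0; have [mq|/ltW qm] := leP (sqnorm (lattice_vec g m')) q0.
  by have [p' e] := box _ mq; rewrite -e; apply: pmin; rewrite e.
by apply: le_trans qm; have := pmin _ P0; rewrite hp0.
Qed.

Lemma euclidean_normE (v : 'rV[R]_2) : euclidean_norm v = Num.sqrt (sqnorm (v 0 0, v 0 1)).
Proof.
rewrite /euclidean_norm big_ord_recl big_ord1 /sqnorm /=; congr (Num.sqrt (_ ^+ 2 + _ ^+ 2)).
by congr (v _ _); apply: val_inj.
Qed.

Lemma lattice_vecE g m : let v := map_mx intr m *m g in (v 0 0, v 0 1) = lattice_vec g m.
Proof. by rewrite /= !mulmx2E !mxE. Qed.

Lemma heightE g m : m != 0 ->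
  (forall m', m' != 0 -> sqnorm (lattice_vec g m) <= sqnorm (lattice_vec g m')) ->
  height (\pi_X g) = (Num.sqrt (sqnorm (lattice_vec g m)))^-1.
Proof.
move=> m0 mmin; rewrite /height lattice_pi; congr (_^-1).
set A := image _ _; set a := Num.sqrt _.
have Aa : A a.
  exists (map_mx intr m *m g); last by rewrite euclidean_normE lattice_vecE.
  split; first by exists m.
  move=> /= e; move: (lattice_vecE g m); rewrite /= e !mxE => e'.
  have : nonzero_lattice g (lattice_vec g m) by exists m.
  by move=> /nonzero_lattice_sqnorm_gt0; rewrite -e' /sqnorm /= expr0n /= addr0 ltxx.
have lA : lbound A a.
  move=> _ [_ [[m' _ <-] nz] <-]; rewrite euclidean_normE lattice_vecE ler_sqrt ?sqnorm_ge0//.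
  by apply: mmin; apply: contra_not_neq nz => ->; rewrite map_mx0 mul0mx.
apply/eqP; rewrite eq_le; apply/andP; split.
  by apply: ge_inf => //; exists a.
by apply: lb_le_inf => //; exists a.
Qed.

Lemma height_gt0 (x : X) : 0 < height x.
Proof.
have [g ->] := pi_surj x; have [m m0 mmin] := shortest_vector g.
by rewrite (heightE m0 mmin) invr_gt0 sqrtr_gt0 (@nonzero_lattice_sqnorm_gt0 g)//; exists m.
Qed.

(** The infimum in [height] is attained, so the closed condition has a witness vector. *)
Lemma height_geP g M : 0 < M ->
  (M <= height (\pi_X g)) <-> exists2 v, nonzero_lattice g v & sqnorm v <= M ^- 2.
Proof.
move=> M0; have [m m0 mmin] := shortest_vector g; rewrite (heightE m0 mmin).
have s0 : 0 < sqnorm (lattice_vec g m) by apply: (@nonzero_lattice_sqnorm_gt0 g); exists m.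
have -> : (M <= (Num.sqrt (sqnorm (lattice_vec g m)))^-1) = (sqnorm (lattice_vec g m) <= M ^- 2).
  rewrite -lef_pV2 ?posrE ?invr_gt0 ?sqrtr_gt0// invrK -(@ler_sqr R) ?nnegrE ?sqrtr_ge0//.
    by rewrite sqr_sqrtr ?(ltW s0)// exprVn.
  by rewrite invr_ge0 ltW.
split; first by exists (lattice_vec g m) => //; exists m.
by move=> [_ [m' m'0 <-]]; apply: le_trans; exact: mmin.
Qed.

End lattice_vectors.

(** * The topology of the modular surface and the geodesic flow on it *)

Section surface_topology.
Variable R : realType.
Local Notation X := (SL2ZSL2R R).
Implicit Types (g h : SL2 R) (e M : R) (m : 'rV[int]_2).

Lemma open_surface (U : set X) : open U <-> forall g, U (\pi_X g) ->
  exists2 e, 0 < e & forall h, near1 e h -> U (\pi_X (SL2_mul g h)).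
Proof.
have -> : open U <-> open (fun g : SL2 R => U (\pi_X g)) by [].
rewrite openE; split=> h g Ug.
  by have /nbhs_SL2_near1 := h g Ug.
by apply/nbhs_SL2_near1; exact: h.
Qed.

Lemma continuous_surface (f : X -> R) : (forall g e, 0 < e -> exists2 e', 0 < e' &
  forall h, near1 e' h -> `|f (\pi_X (SL2_mul g h)) - f (\pi_X g)| < e) -> continuous f.
Proof.
move=> cf; apply/continuousP => A oA; apply/open_surface => g Ag.
have /nbhs_ballP[e /= e0 eA] : nbhs (f (\pi_X g)) A by exact: open_nbhs_nbhs.
have [e' e'0 h'] := cf g e e0; exists e' => // h /h' fe.
by apply: eA; rewrite /ball/= distrC.
Qed.

Lemma open_measurable_surface (U : set X) : open U -> measurable U.
Proof. exact: sub_sigma_algebra. Qed.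

Lemma measurable_fun_surface (f : X -> X) :
  (forall U, open U -> open (f @^-1` U)) -> measurable_fun setT f.
Proof.
move=> cf; apply: (measurability (@open X)) => //.
move=> _ [U oU <-]; rewrite setTI; apply: open_measurable_surface; exact: cf.
Qed.

Definition geodesic_power j : SL2 R := iter j (fun g => SL2_mul g (mkSL2 (det_geodesic_mx R))) (SL2_1 R).

Lemma geodesic_powerE j : [/\ geodesic_power j 0 0 = expR (j%:R / 2),
  geodesic_power j 0 1 = 0, geodesic_power j 1 0 = 0 & geodesic_power j 1 1 = expR (- (j%:R / 2))].
Proof.
elim: j => [|j [IH0 IH1 IH2 IH3]].
  by rewrite mul0r oppr0 expR0 !mxE.
rewrite [geodesic_power _]/= !SL2_mulE /= IH0 IH1 IH2 IH3 !mxE /=.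
rewrite !mulr0n !mulr1n !mul0r !mulr0 !addr0 !add0r -natr1 -!expRD.
by split => //; congr expR; lra.
Qed.

Lemma iter_geodesic_map j g :
  iter j (@geodesic_map R) (\pi_X g) = \pi_X (SL2_mul g (geodesic_power j)).
Proof.
elim: j => [|j IH]; first by rewrite /= SL2_mul1.
by rewrite iterS IH geodesic_map_pi -SL2_mulA.
Qed.

Lemma expR_halves (x : R) : expR x = expR (x / 2) ^+ 2 /\ expR (- x) = expR (- (x / 2)) ^+ 2.
Proof. by split; rewrite expr2 -expRD; congr expR; lra. Qed.

Lemma sqnorm_geodesic_power g j m :
  sqnorm (lattice_vec (SL2_mul g (geodesic_power j)) m) = flow_sqnorm j 0 (lattice_vec g m).
Proof.
have [e0 e1 e2 e3] := geodesic_powerE j.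
rewrite /sqnorm /flow_sqnorm /= !SL2_mulE e0 e1 e2 e3 !mulr0 !addr0 !add0r mul0r addr0.
by have [-> ->] := expR_halves j%:R; ring.
Qed.

Definition conj_power j h := SL2_mul (SL2_inv (geodesic_power j)) (SL2_mul h (geodesic_power j)).

(** Conjugation by the flow contracts the upper entry and expands the lower one: lower unipotents
    are the unstable direction. *)
Lemma conj_powerE j h : [/\ conj_power j h 0 0 = h 0 0,
  conj_power j h 0 1 = expR (- j%:R) * h 0 1, conj_power j h 1 0 = expR j%:R * h 1 0 &
  conj_power j h 1 1 = h 1 1].
Proof.
have [e0 e1 e2 e3] := geodesic_powerE j.
have [-> ->] := expR_halves j%:R.
rewrite /conj_power !SL2_mulE !SL2_ofE e0 e1 e2 e3.
have := expRxMexpNx_1 (j%:R / 2 : R); set E := expR _; set E' := expR _ => EE.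
split; rewrite ?oppr0 ?mul0r ?mulr0 ?addr0 ?add0r; try ring.
  by rewrite mulrCA (mulrC E') EE mulr1.
by rewrite mulrCA EE mulr1.
Qed.

Lemma mul_geodesic_power g h j : SL2_mul (SL2_mul g h) (geodesic_power j) =
  SL2_mul (SL2_mul g (geodesic_power j)) (conj_power j h).
Proof. by rewrite /conj_power !SL2_mulA SL2_mulK. Qed.

Lemma open_preimage_geodesic_map (U : set X) : open U -> open (@geodesic_map R @^-1` U).
Proof.
move=> /open_surface oU; apply/open_surface => g /=.
have pE (g' : SL2 R) : geodesic_map (\pi_X g') = \pi_X (SL2_mul g' (geodesic_power 1)).
  exact: (iter_geodesic_map 1).
rewrite pE => /oU[e e0 eU].
exists (e / expR 1); first by rewrite divr_gt0 ?expR_gt0.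
move=> h [h1 h2 h3 h4]; rewrite pE mul_geodesic_power; apply: eU.
have [e00 e01 e10 e11] := conj_powerE 1 h.
have E1 : 1 <= expR 1 :> R by rewrite -[leLHS](@expR0 R) ler_expR.
have le1 : e / expR 1 <= e by rewrite ler_pdivrMr ?expR_gt0// ler_peMr// ltW.
split; rewrite ?e00 ?e01 ?e10 ?e11; [exact: lt_le_trans le1| | |exact: lt_le_trans le1].
  rewrite normrM ger0_norm ?expR_ge0//; apply: le_lt_trans (lt_le_trans h2 le1).
  by rewrite ler_piMl// -[leRHS](@expR0 R) ler_expR.
by rewrite normrM ger0_norm ?expR_ge0// mulrC -ltr_pdivlMr ?expR_gt0.
Qed.

Lemma measurable_geodesic_map : measurable_fun setT (@geodesic_map R).
Proof. by apply: measurable_fun_surface => U; exact: open_preimage_geodesic_map. Qed.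

(** The image of [v] differs from [v] by a vector of norm at most [2 * e] times that of [v].
    Splitting the square with weights [1 + 2 * e] and [1 + (2 * e)^-1] recovers the squared triangle
    inequality exactly. *)
Lemma sqnorm_near1 g h e m : near1 e h ->
  sqnorm (lattice_vec (SL2_mul g h) m) <= (1 + 2 * e) ^+ 2 * sqnorm (lattice_vec g m).
Proof.
move=> [h1 h2 h3 h4]; have e0 : 0 < e by exact: le_lt_trans h1.
set v := lattice_vec g m.
have -> : lattice_vec (SL2_mul g h) m =
    (v.1 * h 0 0 + v.2 * h 1 0, v.1 * h 0 1 + v.2 * h 1 1).
  by rewrite /lattice_vec /v /= !SL2_mulE; congr (_, _); ring.
pose a := v.1 * (h 0 0 - 1) + v.2 * h 1 0; pose b := v.1 * h 0 1 + v.2 * (h 1 1 - 1).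
have sq x : `|x| < e -> x ^+ 2 <= e ^+ 2.
  by move=> xe; rewrite -(real_normK (num_real x)) lerXn2r ?nnegrE ?(ltW e0) ?(ltW xe).
have s2 (x y : R) : (x + y) ^+ 2 <= 2 * x ^+ 2 + 2 * y ^+ 2.
  by have := sqr_ge0 (x - y); nra.
have A (x y c d : R) : c ^+ 2 <= e ^+ 2 -> d ^+ 2 <= e ^+ 2 ->
    (x * c + y * d) ^+ 2 <= 2 * e ^+ 2 * (x ^+ 2 + y ^+ 2).
  move=> ce de; apply: le_trans (s2 _ _) _; rewrite !exprMn.
  have := ler_wpM2l (sqr_ge0 x) ce; have := ler_wpM2l (sqr_ge0 y) de; lra.
have a2 := A v.1 v.2 _ _ (sq _ h1) (sq _ h3).
have b2 := A v.1 v.2 _ _ (sq _ h2) (sq _ h4).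
rewrite {1}/sqnorm /=.
have -> : v.1 * h 0 0 + v.2 * h 1 0 = v.1 + a by rewrite /a; ring.
have -> : v.1 * h 0 1 + v.2 * h 1 1 = v.2 + b by rewrite /b; ring.
rewrite -/a in a2; rewrite -/b in b2.
have key (x c : R) : (x + c) ^+ 2 <= (1 + 2 * e) * x ^+ 2 + (1 + (2 * e)^-1) * c ^+ 2.
  have := sqr_ge0 (2 * e * x - c).
  have e2 : 0 < (2 * e)^-1 by rewrite invr_gt0 mulr_gt0.
  move=> /(ler_wpM2l (ltW e2)); rewrite mulr0.
  rewrite (_ : (2 * e)^-1 * (2 * e * x - c) ^+ 2 = 2 * e * x ^+ 2 - 2 * x * c + (2 * e)^-1 * c ^+ 2); last first.
    by field; rewrite gt_eqF.
  lra.
apply: le_trans (lerD (key _ _) (key _ _)) _; rewrite /sqnorm.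
have e2 : 0 < 1 + (2 * e)^-1 by rewrite addr_gt0// invr_gt0 mulr_gt0.
have := ler_wpM2l (ltW e2) (lerD a2 b2).
rewrite (_ : _ * (2 * e ^+ 2 * _ + _) = (4 * e ^+ 2 + 2 * e) * (v.1 ^+ 2 + v.2 ^+ 2)); last first.
  by field; rewrite gt_eqF.
lra.
Qed.

Lemma height_near1 g h e : near1 e h -> height (\pi_X (SL2_mul g h)) <= (1 + 2 * e) * height (\pi_X g).
Proof.
move=> he; have e0 : 0 < e by case: he => h1 _ _ _; exact: le_lt_trans h1.
have E0 : 0 < 1 + 2 * e by lra.
set g' := SL2_mul g h; have H0 := height_gt0 (\pi_X g').
rewrite -ler_pdivrMl// mulrC.
have [v [m m0 <-] mv] := (height_geP g' H0).1 (lexx _).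
apply/(height_geP g); first by rewrite divr_gt0.
exists (lattice_vec g m); first by exists m.
rewrite -(SL2_mulK g h); apply: le_trans (sqnorm_near1 _ _ (near1_inv he)) _.
rewrite -/g' expr_div_n invfM invrK mulrC; apply: le_trans (ler_wpM2r (sqr_ge0 _) mv) _.
by [].
Qed.

Lemma height_continuous : continuous (@height R).
Proof.
apply: continuous_surface => g e e0; set H := height (\pi_X g).
have H0 : 0 < H := height_gt0 _.
have d0 : 0 < Num.min 1 (e / (8 * H)) by rewrite lt_min ltr01 divr_gt0// mulr_gt0.
exists (Num.min 1 (e / (8 * H))) => // h hd.
have h1 := height_near1 g hd.
have h2 := height_near1 (SL2_mul g h) (near1_inv hd); rewrite SL2_mulK in h2.
move: hd d0 h1 h2; rewrite -/H; set d := Num.min _ _ => hd d0.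
set H' := height _ => h1 h2.
have [dle1 dH] : d <= 1 /\ d * (8 * H) <= e.
  split; first by rewrite ge_min lexx.
  by rewrite -ler_pdivlMr ?mulr_gt0// ge_min lexx orbT.
by rewrite ltr_norml; apply/andP; split; nra.
Qed.

Lemma measurable_height_ge M : measurable (@height_ge R M).
Proof.
have -> : @height_ge R M = ~` (@height R @^-1` [set y | y < M]).
  by apply/seteqP; split=> x; rewrite /height_ge /= leNgt => /negP.
apply: measurableC; apply: open_measurable_surface.
by apply: open_comp; [move=> x _; exact: height_continuous|exact: open_lt].
Qed.

End surface_topology.

(** * Uniformly separated approximations of partitions *)

Section probability_facts.
Context d (T : measurableType d) (R : realType) (mu : probability T R).
Local Notation Pr A := (fine (mu A)).
Implicit Types A B : set T.

Lemma mu_fin A : measurable A -> mu A \is a fin_num.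
Proof. by move=> mA; exact: fin_num_measure. Qed.

Lemma Pr_ge0 A : 0 <= Pr A.
Proof. exact/fine_ge0/measure_ge0. Qed.

Lemma Pr_le A B : measurable A -> measurable B -> A `<=` B -> Pr A <= Pr B.
Proof.
by move=> mA mB AB; apply: fine_le; rewrite ?mu_fin// le_measure ?inE.
Qed.

Lemma Pr_setU A B : measurable A -> measurable B -> Pr (A `|` B) <= Pr A + Pr B.
Proof.
move=> mA mB; rewrite -fineD ?mu_fin//; apply: fine_le; rewrite ?fin_numD ?mu_fin//.
  exact: measurableU.
exact: measureU2.
Qed.

Lemma Pr_setC A : measurable A -> Pr (~` A) = 1 - Pr A.
Proof. by move=> mA; rewrite probability_setC// fineB ?mu_fin. Qed.

Lemma Pr_bigsetU (k : nat) (F : 'I_k -> set T) (a : R) :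
  (forall i, measurable (F i)) -> (forall i, Pr (F i) <= a) ->
  Pr (\big[setU/set0]_i F i) <= k%:R * a.
Proof.
elim: k F => [|k IH] F mF Fa; first by rewrite big_ord0 measure0 mul0r.
rewrite big_ord_recl -natr1 mulrDl mul1r addrC.
apply: le_trans (Pr_setU _ _) _ => //; first exact: bigsetU_measurable.
by apply: lerD => //; apply: IH.
Qed.

Lemma Pr_decreasing_small (F : nat -> set T) (dlt : R) : 0 < dlt ->
  (forall n, measurable (F n)) -> (forall n m, (n <= m)%N -> F m `<=` F n) ->
  \bigcap_n F n = set0 -> exists n, Pr (F n) < dlt.
Proof.
move=> d0 mF decF F0.
have := @nonincreasing_cvg_mu _ _ _ mu F _ mF.
rewrite F0 measure0 => /(_ _ measurable0) h.
have {h} /fine_cvgP[_ /cvgrPdist_lt /(_ _ d0) [N _ /(_ N (leqnn N))]] :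
    mu (F n) @[n --> \oo] --> (0 : R)%:E.
  apply: h; first by rewrite (le_lt_trans (probability_le1 mu (mF 0%N))) ?ltry.
  by move=> n m nm; apply/subsetPset/decF.
by rewrite /= sub0r normrN ger0_norm ?Pr_ge0// => ?; exists N.
Qed.

End probability_facts.

Section separated_approximation.
Variable R : realType.
Local Notation X := (SL2ZSL2R R).
Variable mu : probability X R.
Local Notation Pr A := (fine (mu A)).
Implicit Types (g h : SL2 R) (e dlt : R) (A B K L : set X).

Lemma near1_open e k : near1 e k -> exists2 e', 0 < e' & forall k', near1 e' k' -> near1 e (SL2_mul k k').
Proof.
move=> [h1 h2 h3 h4]; have : nbhs k (near1 e); last by move=> /nbhs_SL2_near1.
apply/nbhs_SL2.
pose m := Num.min (Num.min (e - `|k 0 0 - 1|) (e - `|k 0 1|))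
                  (Num.min (e - `|k 1 0|) (e - `|k 1 1 - 1|)).
exists m; first by rewrite !lt_min !subr_gt0 h1 h2 h3 h4.
move=> g gm.
have aux (a b c : R) : `|a - b| < m -> m <= e - `|b - c| -> `|a - c| < e.
  move=> ab mb; have -> : a - c = (a - b) + (b - c) by ring.
  by apply: le_lt_trans (ler_normD _ _) _; lra.
split; [apply: (aux _ (k 0 0))|rewrite -[g 0 1]subr0; apply: (aux _ (k 0 1))|
  rewrite -[g 1 0]subr0; apply: (aux _ (k 1 0))|apply: (aux _ (k 1 1))];
  by rewrite ?subr0 ?gm// /m !ge_min lexx ?orbT.
Qed.

Lemma pi_mulr g g' k : \pi_X g = \pi_X g' -> \pi_X (SL2_mul g k) = \pi_X (SL2_mul g' k).
Proof.
move=> gg; have : in_SL2Z_orbit g g'.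
  have [u du e] := eq_orbit_repr g; have := in_SL2Z_orbitC (eq_orbit_repr g').
  rewrite -gg => -[v dv e']; exists (v *m u); first by rewrite det_mulmx du dv mulr1.
  by rewrite e' e map_mxM mulmxA.
move=> [u du e]; apply/eqmodP/asboolP; exists u => //.
by rewrite /= e mulmxA.
Qed.

Definition cell g e : set X := [set x | exists2 k, near1 e k & x = \pi_X (SL2_mul g k)].

Lemma open_cell g e : open (cell g e).
Proof.
apply/open_surface => g' [k ke e']; have [d d0 hd] := near1_open ke.
exists d => // h /hd kh; exists (SL2_mul k h) => //.
by rewrite SL2_mulA; exact: pi_mulr.
Qed.

(** Uniform separation, with small right translations in place of a metric on the quotient. *)
Definition separated e K L := forall g h, near1 e h -> K (\pi_X g) -> ~ L (\pi_X (SL2_mul g h)).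

Lemma separatedC e K L : separated e K L -> separated e L K.
Proof.
move=> s g h he Lg Kgh; apply: (s _ _ (near1_inv he) Kgh).
by rewrite SL2_mulK.
Qed.

Lemma separatedW e e' K K' L L' : e' <= e -> K' `<=` K -> L' `<=` L ->
  separated e K L -> separated e' K' L'.
Proof.
move=> ee KK LL s g h he Kg Lgh.
by apply: (s g h); [exact: near1W he|exact: KK|exact: LL].
Qed.

(** Inner approximation of [A] and of its complement at once, by uniformly separated sets. The
    symmetry gives stability under complement, and the class turns out to be a sigma-algebra
    containing the open sets. *)
Definition approximable A := measurable A /\ forall dlt, 0 < dlt ->
  exists e K L, [/\ 0 < e, measurable K /\ measurable L, K `<=` A /\ L `<=` ~` A,
    separated e K L & Pr (A `\` K) <= dlt /\ Pr (~` A `\` L) <= dlt].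

Lemma approximableC A : approximable A -> approximable (~` A).
Proof.
move=> [mA hA]; split; first exact: measurableC.
move=> dlt d0; have [e [K [L [e0 [mK mL] [KA LA] s [h1 h2]]]]] := hA _ d0.
exists e, L, K; split => //; first by rewrite setCK.
  exact: separatedC.
by rewrite setCK.
Qed.

Lemma approximableU A B : approximable A -> approximable B -> approximable (A `|` B).
Proof.
move=> [mA hA] [mB hB]; split; first exact: measurableU.
move=> dlt d0; have d2 : 0 < dlt / 2 by rewrite divr_gt0.
have [e [K [L [e0 [mK mL] [KA LA] s [h1 h2]]]]] := hA _ d2.
have [e' [K' [L' [e'0 [mK' mL'] [KB LB] s' [h1' h2']]]]] := hB _ d2.
exists (Num.min e e'), (K `|` K'), (L `&` L'); split.
- by rewrite lt_min e0.
- by split; [exact: measurableU|exact: measurableI].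
- split; first exact: setUSS.
  by rewrite setCU; exact: setISS.
- move=> g h he [Kg|Kg] [Lg Lg'].
    by apply: (s g h) => //; apply: near1W he; rewrite ge_min lexx.
  by apply: (s' g h) => //; apply: near1W he; rewrite ge_min lexx orbT.
have mD := @measurableD _ X; split.
  apply: (@le_trans _ _ (Pr ((A `\` K) `|` (B `\` K')))).
    apply: Pr_le; [|apply: measurableU; exact: mD|].
      by apply: mD; exact: measurableU.
    by move=> x [[Ax|Bx] /not_orP[nK nK']]; [left|right].
  by apply: le_trans (Pr_setU _ _ _) _; [exact: mD|exact: mD|lra].
have mCA := measurableC mA; have mCB := measurableC mB.
apply: (@le_trans _ _ (Pr ((~` A `\` L) `|` (~` B `\` L')))).
  apply: Pr_le; [|apply: measurableU; exact: mD|].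
    by apply: mD; [exact/measurableC/measurableU|exact: measurableI].
  move=> x [/not_orP[nA nB] /not_andP[nL|nL]]; [by left|by right].
by apply: le_trans (Pr_setU _ _ _) _; [exact: mD|exact: mD|lra].
Qed.

(** A pair for one [F N] of nearly full measure in the union also serves the union, once the union
    is removed from [L]. This loses nothing, as the complement of the union lies in that of
    [F N]. *)
Lemma approximable_increasing (F : nat -> set X) :
  (forall n, approximable (F n)) -> (forall n m, (n <= m)%N -> F n `<=` F m) ->
  approximable (\bigcup_n F n).
Proof.
move=> hF incF; set A := \bigcup_n F n.
have mF n : measurable (F n) by case: (hF n).
have mA : measurable A by exact: bigcupT_measurable.
have mD := @measurableD _ X.
split => // dlt d0; have d2 : 0 < dlt / 2 by rewrite divr_gt0.
have [N hN] : exists n, Pr (A `\` F n) < dlt / 2.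
  apply: Pr_decreasing_small => //; first by move=> n; exact: mD.
    by move=> n m nm; apply: setDS; exact: incF.
  by rewrite -subset0 => x h; have [[n _ Fn] _] := h 0%N I; have [] := h n I.
have [_ hFN] := hF N.
have [e [K [L [e0 [mK mL] [KA LA] s [h1 h2]]]]] := hFN _ d2.
have FA : F N `<=` A by move=> x ?; exists N.
exists e, K, (L `&` ~` A); split => //.
- by split => //; apply: measurableI => //; exact: measurableC.
- by split; [exact: subset_trans KA FA|move=> x []].
- by apply: separatedW s => // x [].
split.
  apply: (@le_trans _ _ (Pr ((A `\` F N) `|` (F N `\` K)))).
    apply: Pr_le; [exact: mD|apply: measurableU; exact: mD|].
    by move=> x [Ax nK]; have [Fx|nF] := pselect (F N x); [right|left].
  by apply: le_trans (Pr_setU _ _ _) _; [exact: mD|exact: mD|lra].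
apply: (@le_trans _ _ (Pr (~` F N `\` L))); last lra.
apply: Pr_le; [|by apply: mD => //; exact: measurableC|].
  apply: mD; first exact: measurableC.
  by apply: measurableI => //; exact: measurableC.
by move=> x [nA /not_andP[nL|//]]; split => // /FA.
Qed.

(** [K n] consists of the points that translations by [near1] of size [1 / (n + 1)] cannot carry out
    of [A]; since [A] is open, these sets exhaust it. *)
Lemma approximable_open A : open A -> approximable A.
Proof.
move=> oA; have mA := open_measurable_surface oA.
have mD := @measurableD _ X.
split=> // dlt d0.
pose U e := \bigcup_(g in [set g | ~ A (\pi_X g)]) cell g e.
have oU e : open (U e) by apply: bigcup_open => g _; exact: open_cell.
pose K n := ~` U n.+1%:R^-1.
have mK n : measurable (K n) by apply: measurableC; apply: open_measurable_surface; exact: oU.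
have near1_1' n : near1 (n.+1%:R^-1 : R) (SL2_1 R) by apply: near1_1; rewrite invr_gt0.
have KA n : K n `<=` A.
  move=> x; have [g ->] := pi_surj x => nU; apply: contrapT => nA; apply: nU.
  by exists g => //; exists (SL2_1 R) => //; rewrite SL2_mul1.
have [N hN] : exists n, Pr (A `\` K n) < dlt.
  apply: Pr_decreasing_small => //; first by move=> n; exact: mD.
    move=> n m nm; apply: setDS; apply: subsetC => x [g nA [k ke ->]].
    exists g => //; exists k => //; apply: near1W ke.
    by rewrite lef_pV2 ?posrE// ler_nat.
  rewrite -subset0 => x h; have [Ax _] := h 0%N I; have [g e'] := pi_surj x.
  move: Ax; rewrite e' => Ax; have [e e0 he] := (open_surface A).1 oA g Ax.
  have [n ne] : exists n : nat, n.+1%:R^-1 <= e.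
    have ei : 0 < e^-1 by rewrite invr_gt0.
    have /andP[_ lt] := truncn_itv (ltW ei); exists (Num.trunc e^-1).
    by rewrite -[leRHS]invrK lef_pV2 ?posrE// ltW.
  have [_ nK] := h n I; apply: nK; rewrite e' => -[g' nA [k ke eq]].
  apply: nA; have := he _ (near1_inv (near1W ne ke)).
  by rewrite (pi_mulr _ eq) SL2_mulK.
exists N.+1%:R^-1, (K N), (~` A); split.
- by rewrite invr_gt0.
- by split; [exact: mK|exact: measurableC].
- by split; [exact: KA|].
- move=> g h he Kg nA; apply: Kg; exists (SL2_mul g h) => //.
  by exists (SL2_inv h); [exact: near1_inv|rewrite SL2_mulK].
- by split; [exact: ltW|rewrite setDv measure0 ltW].
Qed.

Lemma approximable_measurable A : measurable A -> approximable A.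
Proof.
move: A; apply: (@smallest_sub _ _ (@open X) approximable).
  have h0 : approximable set0 by apply: approximable_open; exact: open0.
  split => //; first by move=> A hA; rewrite setTD; exact: approximableC.
  move=> F hF.
  have -> : \bigcup_n F n = \bigcup_n \big[setU/set0]_(i < n.+1) F i.
    by rewrite bigcup_bigsetU_bigcup.
  apply: approximable_increasing.
    move=> n; elim: n.+1 => [|m IH]; first by rewrite big_ord0.
    by rewrite big_ord_recr/=; exact: approximableU.
  by move=> n m nm; apply: subset_bigsetU.
exact: approximable_open.
Qed.

(** Outside the union [ZZ] of the approximation errors, a point of [P i] lies in the inner set of
    [P i], and a point of any other cell in the inner set of its complement; these two are
    separated. *)
Lemma separated_partition k (P : 'I_k -> set X) dlt :
  (forall i, measurable (P i)) -> partition setT P setT -> 0 < dlt ->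
  exists e (K : 'I_k -> set X), [/\ 0 < e, forall i, measurable (K i),
    forall i, K i `<=` P i, forall i j, i != j -> separated e (K i) (K j) &
    Pr (~` \bigcup_i K i) <= dlt].
Proof.
move=> mP [cP tP _] d0.
pose d1 := dlt / (2 * k%:R + 1).
have k0 : 0 < 2 * k%:R + 1 :> R by rewrite ltr_wpDl// mulr_ge0.
have d10 : 0 < d1 by rewrite divr_gt0.
have /choice[w hw] i : exists w : R * (set X * set X),
    [/\ 0 < w.1, measurable w.2.1 /\ measurable w.2.2,
     w.2.1 `<=` P i /\ w.2.2 `<=` ~` P i, separated w.1 w.2.1 w.2.2 &
     Pr (P i `\` w.2.1) <= d1 /\ Pr (~` P i `\` w.2.2) <= d1].
  have [_ /(_ _ d10)[e [K [L h]]]] := approximable_measurable (mP i).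
  by exists (e, (K, L)).
have mD := @measurableD _ X.
have mP' i := measurableC (mP i).
pose Z i := (P i `\` (w i).2.1) `|` (~` P i `\` (w i).2.2).
have mZ i : measurable (Z i).
  by have [_ [mK mL] _ _ _] := hw i; apply: measurableU; exact: mD.
have ZP i : Pr (Z i) <= 2 * d1.
  have [_ [mK mL] _ _ [h1 h2]] := hw i.
  by apply: le_trans (Pr_setU _ _ _) _; [exact: mD|exact: mD|lra].
have [e e0 he] : exists2 e, 0 < e & forall i, e <= (w i).1.
  have w0 i : 0 < (w i).1 by case: (hw i).
  have S0 : 0 < 1 + \sum_i (w i).1^-1.
    by rewrite ltr_pwDl// sumr_ge0// => i _; rewrite invr_ge0 ltW.
  exists (1 + \sum_i (w i).1^-1)^-1; first by rewrite invr_gt0.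
  move=> i; rewrite -[leRHS]invrK lef_pV2 ?posrE ?invr_gt0// (bigD1 i)//= addrCA lerDl.
  by rewrite addr_ge0// sumr_ge0// => j _; rewrite invr_ge0 ltW.
pose ZZ := \big[setU/set0]_i Z i.
have mZZ : measurable ZZ by exact: bigsetU_measurable.
have ZZP : Pr ZZ <= dlt.
  apply: le_trans (Pr_bigsetU mZ ZP) _; rewrite mulrA /d1 mulrA ler_pdivrMr// mulrC.
  by rewrite ler_wpM2l ?ltW//; lra.
exists e, (fun i => P i `\` ZZ); split => //.
- by move=> i; exact: mD.
- move=> i j ij; have [_ _ [KP LP] s _] := hw i.
  apply: separatedW (he i) _ _ s => x [Px nZ].
    by apply: contrapT => nK; apply: nZ; rewrite /ZZ (bigD1 i)//=; left; left.
  apply: contrapT => nL; apply: nZ; rewrite /ZZ (bigD1 i)//=; left; right; split => //.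
  by move=> Pi; move/eqP: ij; apply; apply: (tP _ _ I I); exists x.
apply: le_trans ZZP; apply: Pr_le => //.
  by apply/measurableC/fin_bigcup_measurable => // i _; exact: mD.
move=> x nK; have : [set: X] x by [].
rewrite -cP => -[i _ Px]; apply: contrapT => nZ; apply: nK.
by exists i.
Qed.

End separated_approximation.

(** * Mahler compactness *)

Section mahler_compactness.
Variable R : realType.
Local Notation X := (SL2ZSL2R R).
Implicit Types (g h : SL2 R) (C H : R).

Lemma ultra_bounded_cvg (T : Type) (F : set_system T) (f : T -> R) C : UltraFilter F ->
  F [set x | `|f x| <= C] -> exists2 a, `|a| <= C & f x @[x --> F] --> a.
Proof.
move=> uF FC.
have FI : F (f @^-1` `[- C, C]).
  by apply: filterS FC => x /=; rewrite in_itv/= -ler_norml.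
have /(_ (f @ F) _ FI)[a [aC cla]] := @segment_compact R (- C) C.
exists a; first by rewrite ler_norml; move: aC; rewrite /= in_itv.
move=> V nV; have [//|FnV] := in_ultra_setVsetC (f @^-1` V) uF.
have fF : (f @ F) (~` V) by exact: FnV.
by have [y []] := cla _ _ fF nV.
Qed.

(** Along an ultrafilter the four bounded entries converge, and the determinant passes to the
    limit. *)
Lemma compact_bounded_SL2 C : compact [set g : SL2 R | forall i j, `|g i j| <= C].
Proof.
rewrite compact_ultra => F uF FC; have pF : ProperFilter F by exact: ultra_proper.
have ex i j : exists2 a : R, `|a| <= C & (fun g : SL2 R => g i j) x @[x --> F] --> a.
  by apply: ultra_bounded_cvg; apply: filterS FC => g; exact.
have [a aC ca] := ex 0 0; have [b bC cb] := ex 0 1.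
have [c cC cc] := ex 1 0; have [d dC cd] := ex 1 1.
have det : a * d - b * c = 1.
  have h1 : (fun g : SL2 R => g 0 0 * g 1 1 - g 0 1 * g 1 0) x @[x --> F] --> a * d - b * c.
    by apply: cvgB; exact: cvgM.
  have h2 : (fun g : SL2 R => g 0 0 * g 1 1 - g 0 1 * g 1 0) x @[x --> F] --> (1 : R).
    rewrite (_ : (fun g : SL2 R => _) = fun=> 1); first exact: cvg_cst.
    by apply/funext => g; exact: SL2_det2.
  exact: (cvg_unique (@Rhausdorff R) h1 h2).
have E := SL2_ofE det; exists (SL2_of det); split.
  by move=> i j; move: i j; apply: ord2_split; apply: ord2_split; rewrite E.
move=> A /nbhs_SL2[e e0 eA].
have near (x : SL2 R -> R) (l : R) : x @ F --> l -> F [set g | `|x g - l| < e].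
  by move=> /cvgrPdist_lt /(_ _ e0); apply: filterS => g; rewrite distrC.
have h1 := near _ _ ca; have h2 := near _ _ cb.
have h3 := near _ _ cc; have h4 := near _ _ cd.
have : F A; last by [].
apply: filterS (filterI (filterI h1 h2) (filterI h3 h4)) => g [[k1 k2] [k3 k4]].
apply: eA.
by apply: ord2_split; apply: ord2_split; rewrite E.
Qed.

(** A shortest vector is primitive, since dividing it by the gcd of its coordinates would shorten
    it; Bezout then completes it to a basis. *)
Lemma bezout_primitive g (m : 'rV[int]_2) : m != 0 ->
  (forall m' : 'rV[int]_2, m' != 0 -> sqnorm (lattice_vec g m) <= sqnorm (lattice_vec g m')) ->
  exists n : 'rV[int]_2, m 0 0 * n 0 1 - m 0 1 * n 0 0 = 1.
Proof.
move=> m0 mmin; have [u [v uv]] := Bezoutz (m 0 0) (m 0 1).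
set d := gcdz _ _ in uv.
have /dvdzP[q0 e0] : (d %| (m 0 0)%R)%Z := dvdz_gcdl _ _.
have /dvdzP[q1 e1] : (d %| (m 0 1)%R)%Z := dvdz_gcdr _ _.
pose q : 'rV[int]_2 := \row_j if j == 0 then q0 else q1.
have mE : lattice_vec g m = (d%:~R * (lattice_vec g q).1, d%:~R * (lattice_vec g q).2).
  by rewrite /lattice_vec !mxE /= e0 e1 !rmorphM /=; congr (_, _); ring.
have dn0 : d != 0.
  by apply: contraTneq m0 => dz; rewrite introw_neq0 e0 e1 dz !mulr0 eqxx.
have q_neq0 : q != 0.
  by apply: contraTneq m0 => /rowP qz; rewrite introw_neq0 e0 e1;
    have := qz 0; have := qz 1; rewrite !mxE /= => -> ->; rewrite !mul0r eqxx.
have q_gt0 : 0 < sqnorm (lattice_vec g q) by apply: (@nonzero_lattice_sqnorm_gt0 _ g); exists q.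
have d2 : d ^+ 2 <= 1.
  have := mmin _ q_neq0; rewrite mE.
  have -> : sqnorm (d%:~R * (lattice_vec g q).1, d%:~R * (lattice_vec g q).2)
     = d%:~R ^+ 2 * sqnorm (lattice_vec g q) by rewrite /sqnorm /=; ring.
  rewrite ger_pMl// -rmorphXn /= => h; rewrite -(ler_int R); exact: h.
have d1 : d = 1.
  have : 0 <= d by rewrite /d /gcdz.
  by move: d2 dn0; nia.
exists (\row_j if j == 0 then - v else u); rewrite !mxE /= -d1 -uv; ring.
Qed.

(** Lagrange-Gauss reduction: [v] is shortest, and [w'] completes it to a basis with projection at
    most half of [v]. As the covolume is 1, [|v|^2 |w'|^2 = (v . w')^2 + 1], so [|v|] is bounded
    absolutely and [|w'|] in terms of [H]. *)
Lemma reduced_representative (x : X) H : 0 <= H -> height x <= H ->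
  exists2 g : SL2 R, x = \pi_X g & forall i j, `|g i j| <= H + 2.
Proof.
move=> H0 xH; have [g xE] := pi_surj x.
have [m m0 mmin] := shortest_vector g.
have [n mn] := bezout_primitive m0 mmin.
pose v := lattice_vec g m; pose w := lattice_vec g n.
have v0 : 0 < sqnorm v by apply: (@nonzero_lattice_sqnorm_gt0 _ g); exists m.
pose t := (v.1 * w.1 + v.2 * w.2) / sqnorm v.
pose k := - Num.floor (t + 2^-1).
have tk : `|t + k%:~R| <= 2^-1.
  have := floor_itv (t + 2^-1); rewrite /k rmorphD rmorphN /= => /andP[h1 h2].
  by rewrite ler_norml; apply/andP; split; lra.
pose n' : 'rV[int]_2 := \row_j (n 0 j + k * m 0 j).
have mn' : m 0 0 * n' 0 1 - m 0 1 * n' 0 0 = 1 by rewrite !mxE -mn; ring.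
pose w' := lattice_vec g n'.
have w'E : w' = (w.1 + k%:~R * v.1, w.2 + k%:~R * v.2).
  by rewrite /w' /w /v /lattice_vec !mxE !rmorphD !rmorphM /=; congr (_, _); ring.
have n'0 : n' != 0.
  by apply: contraTneq isT => nz; move: mn'; rewrite nz !mxE !mulr0 subr0.
have vw' : sqnorm v <= sqnorm w' by exact: mmin.
have cr : cross v w' = 1 by rewrite cross_lattice_vec mn'.
have dot : (v.1 * w'.1 + v.2 * w'.2) ^+ 2 <= sqnorm v ^+ 2 / 4.
  have -> : v.1 * w'.1 + v.2 * w'.2 = sqnorm v * (t + k%:~R).
    have tv : sqnorm v * t = v.1 * w.1 + v.2 * w.2 by rewrite /t mulrC divfK ?gt_eqF.
    by rewrite [RHS]mulrDr tv w'E /sqnorm /=; ring.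
  rewrite exprMn ler_wpM2l ?sqr_ge0//.
  have : (t + k%:~R) ^+ 2 <= 2^-1 ^+ 2.
    by rewrite -(real_normK (num_real (t + _))) lerXn2r// nnegrE.
  by lra.
have lag : sqnorm v * sqnorm w' = (v.1 * w'.1 + v.2 * w'.2) ^+ 2 + 1.
  by rewrite -[1](expr1n _ 2) -{1}cr /sqnorm /cross; ring.
have hv : H ^+ 2 * sqnorm v >= 1.
  move: xH; rewrite xE (heightE m0 mmin) => xH.
  have s0 : 0 < Num.sqrt (sqnorm v) by rewrite sqrtr_gt0.
  have : 1 <= H * Num.sqrt (sqnorm v) by rewrite -ler_pdivrMr// mul1r.
  move=> h; have : 1 ^+ 2 <= (H * Num.sqrt (sqnorm v)) ^+ 2 by rewrite lerXn2r ?nnegrE ?mulr_ge0 ?sqrtr_ge0.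
  by rewrite expr1n exprMn sqr_sqrtr// ltW.
have v2 : sqnorm v ^+ 2 <= 4 / 3 by nra.
have v43 : sqnorm v <= 2 by nra.
have w2 : sqnorm w' <= H ^+ 2 + 1.
  have : sqnorm v * sqnorm w' <= sqnorm v * (H ^+ 2 + 1).
    have ss : sqnorm v ^+ 2 <= 2 * sqnorm v by rewrite expr2 ler_wpM2r// ltW.
    rewrite lag; move: v0 dot hv ss; set p := (_ + _) ^+ 2; set q := sqnorm v; lra.
  by rewrite ler_pM2l.
have det : v.1 * w'.2 - v.2 * w'.1 = 1 by exact: cr.
exists (SL2_of det).
  rewrite xE; apply/eqmodP/asboolP.
  exists (\matrix_(i, j) if i == 0 then m 0 j else n' 0 j).
    by rewrite det2E !mxE /=; move: mn'; rewrite !mxE.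
  apply/matrixP; apply: ord2_split; apply: ord2_split;
    rewrite mulmx2E !SL2_ofE ![map_mx _ _ _ _]mxE ![(\matrix_(_, _) _) _ _]mxE //= ?[n' _ _]mxE//.
have bnd (y z : R) : y ^+ 2 + z ^+ 2 <= (H + 2) ^+ 2 -> `|y| <= H + 2 /\ `|z| <= H + 2.
  move=> yz; have H2 : 0 <= H + 2 by lra.
  by split; rewrite -ler_sqr ?nnegrE// real_normK ?num_real//;
     [have := sqr_ge0 z|have := sqr_ge0 y]; lra.
have [v1 v2'] : `|v.1| <= H + 2 /\ `|v.2| <= H + 2.
  by apply: bnd; move: v43; rewrite /sqnorm; nra.
have [w1 w2'] : `|w'.1| <= H + 2 /\ `|w'.2| <= H + 2.
  by apply: bnd; move: w2; rewrite /sqnorm; nra.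
by move=> i j; move: i j; apply: ord2_split; apply: ord2_split; rewrite SL2_ofE.
Qed.

Lemma compact_height_le (A : set X) H : 0 <= H -> closed A ->
  A `<=` [set x | height x <= H] -> compact A.
Proof.
move=> H0 cA AH.
apply: (@subclosed_compact _ _ ((fun g : SL2 R => \pi_X g) @` [set g : SL2 R | forall i j, `|g i j| <= H + 2])) => //.
  apply: continuous_compact; last exact: compact_bounded_SL2.
  by apply: continuous_subspaceT; exact: pi_continuous.
by move=> x /AH /(reduced_representative H0)[g -> gb]; exists g.
Qed.

Lemma finite_cell_cover H e : 0 <= H -> 0 < e ->
  exists s : seq (SL2 R), forall x : X, height x <= H -> exists i : 'I_(size s), cell (nth (SL2_1 R) s i) e x.
Proof.
move=> H0 e0; pose A := [set x : X | height x <= H].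
have cA : compact A.
  apply: (@compact_height_le _ H) => //.
  rewrite (_ : A = @height R @^-1` [set y | y <= H])//.
  by apply: preimage_closed; [move=> x _; exact: height_continuous|exact: closed_le].
move: cA; rewrite compact_cover => /(_ (SL2 R) setT (fun g => cell g e)) [].
- by move=> g _; exact: open_cell.
- by move=> x _; have [g ->] := pi_surj x; exists g => //; exists (SL2_1 R); [exact: near1_1|rewrite SL2_mul1].
move=> D _ Dcov; exists (finmap.enum_fset D) => x /Dcov [g gD gx].
have gi : (index g (finmap.enum_fset D) < size (finmap.enum_fset D))%N by rewrite index_mem.
by exists (Ordinal gi); rewrite /= nth_index.
Qed.

End mahler_compactness.

(** * Entrance times into the cusp *)

Section returns_to_the_cusp.
Variable R : realType.
Local Notation X := (SL2ZSL2R R).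
Local Notation T := (@geodesic_map R).
Implicit Types (g h : SL2 R) (M : R) (v w : R * R).

Lemma height_ge_iterP g M j : 0 < M -> (height_ge M (iter j T (\pi_X g))) <->
  exists2 v, nonzero_lattice g v & flow_sqnorm j 0 v <= M ^- 2.
Proof.
move=> M0; rewrite /height_ge /= iter_geodesic_map; split.
  move=> /(height_geP _ M0)[_ [m m0 <-]] h; exists (lattice_vec g m); first by exists m.
  by rewrite -sqnorm_geodesic_power.
move=> [_ [m m0 <-]] h; apply/(height_geP _ M0).
exists (lattice_vec (SL2_mul g (geodesic_power R j)) m); first by exists m.
by rewrite sqnorm_geodesic_power.
Qed.

Lemma flow_sqnorm_addn_le j k rho v : flow_sqnorm j rho v <= expR k%:R * flow_sqnorm (j + k) rho v.
Proof.
elim: k => [|k IH]; first by rewrite addn0 expR0 mul1r.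
apply: le_trans IH _; rewrite -natr1 expRD -mulrA ler_wpM2l ?expR_ge0// addnS.
by case: (flow_sqnormS (j + k) rho v).
Qed.

(** For [x > 0] the bound says that the convex quadratic [a x^2 - t x + b] is at most 0, which
    happens on an interval. It is applied to [x = exp j]. *)
Lemma quadratic_convex (a b t x1 x x2 : R) : 0 <= a -> 0 < x1 -> x1 <= x -> x <= x2 ->
  a * x1 + b / x1 <= t -> a * x2 + b / x2 <= t -> a * x + b / x <= t.
Proof.
move=> a0 x10 x1x xx2 h1 h2; have x0 : 0 < x by exact: lt_le_trans x1x.
have x20 : 0 < x2 by exact: lt_le_trans xx2.
have q y : 0 < y -> (a * y + b / y <= t) = (a * y ^+ 2 + b <= t * y).
  move=> y0; rewrite -(ler_pM2r y0) mulrDl divfK ?gt_eqF//.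
  by rewrite -mulrA -expr2.
rewrite q// in h1; rewrite q// in h2; rewrite q//.
have [e|ne] := eqVneq x1 x2; first by have -> : x = x1 by apply/eqP; rewrite eq_le x1x e xx2.
have d0 : 0 < x2 - x1 by rewrite subr_gt0 lt_neqAle ne (le_trans x1x).
rewrite -subr_ge0 -(pmulr_rge0 _ d0).
have -> : (x2 - x1) * (t * x - (a * x ^+ 2 + b)) =
  (x2 - x) * (t * x1 - (a * x1 ^+ 2 + b)) + (x - x1) * (t * x2 - (a * x2 ^+ 2 + b))
  + a * (x - x1) * (x2 - x) * (x2 - x1) by ring.
by rewrite !addr_ge0// ?mulr_ge0 ?subr_ge0// (le_trans x1x).
Qed.

Lemma flow_sqnorm_convex j k v (t : R) : (1 <= k)%N ->
  flow_sqnorm j 0 v <= t -> flow_sqnorm (j + k.+1) 0 v <= t -> flow_sqnorm (j + k) 0 v <= t.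
Proof.
move=> k1; rewrite /flow_sqnorm !mul0r !addr0.
have E i : expR i%:R * v.1 ^+ 2 + expR (- i%:R) * v.2 ^+ 2 =
    v.1 ^+ 2 * expR i%:R + v.2 ^+ 2 / expR i%:R.
  by rewrite expRN; ring.
rewrite !E; apply: quadratic_convex; rewrite ?sqr_ge0 ?expR_gt0// ler_expR ler_nat; lia.
Qed.

Lemma flow_sqnorm_parallel v w : 0 < sqnorm v -> cross v w = 0 ->
  exists c, forall j, flow_sqnorm j 0 w = c ^+ 2 * flow_sqnorm j 0 v.
Proof.
move=> v0 vw; pose c := (v.1 * w.1 + v.2 * w.2) / sqnorm v; exists c.
have vn : sqnorm v != 0 by rewrite gt_eqF.
have [w1 w2] : w.1 = c * v.1 /\ w.2 = c * v.2.
  rewrite /c; split; apply: (mulIf vn); rewrite mulrAC divfK//.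
    have -> : w.1 * sqnorm v = (v.1 * w.1 + v.2 * w.2) * v.1 - v.2 * cross v w.
      by rewrite /sqnorm /cross; ring.
    by rewrite vw mulr0 subr0.
  have -> : w.2 * sqnorm v = (v.1 * w.1 + v.2 * w.2) * v.2 + v.1 * cross v w.
    by rewrite /sqnorm /cross; ring.
  by rewrite vw mulr0 addr0.
by move=> j; rewrite /flow_sqnorm w1 w2; ring.
Qed.

(* Independent short vectors need time [4 ln M] to replace each other, and a
   single vector is short during an interval of times. *)
Lemma entering_gap (x : X) M k : 0 < M -> (1 <= k)%N ->
  entering T (height_ge M) x -> entering T (height_ge M) (iter k T x) ->
  M ^+ 4 <= expR k%:R.
Proof.
move=> M0 k1; have [g ->] := pi_surj x.
move=> [_ /(height_ge_iterP g 1 M0)[v Lv v1]] [nYk].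
move=> /(height_ge_iterP g k.+1 M0)[w Lw wk].
have long u : nonzero_lattice g u -> M ^- 2 < flow_sqnorm k 0 u.
  by move=> Lu; rewrite ltNge; apply/negP => h; apply: nYk; apply/(height_ge_iterP g k M0); exists u.
have convex u : nonzero_lattice g u -> flow_sqnorm 1 0 u <= M ^- 2 ->
    flow_sqnorm k.+1 0 u <= M ^- 2 -> False.
  move=> Lu u1 uk; have := long _ Lu; rewrite ltNge => /negP; apply.
  case: k k1 uk {wk nYk long} => [//|[|k]] _ uk; first exact: u1.
  by have := @flow_sqnorm_convex 1 k.+1 u (M ^- 2) isT u1; rewrite !add1n; apply.
(* Parallel vectors keep a constant ratio of norms, so the shorter one is short at both times 1 and
   [k + 1], hence by convexity at time [k], when the orbit is outside the cusp. *)
have [c0|cn0] := eqVneq (cross v w) 0.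
  have [c hc] := flow_sqnorm_parallel (nonzero_lattice_sqnorm_gt0 Lv) c0.
  have [c1|c1] := leP (c ^+ 2) 1.
    exfalso; apply: (convex _ Lw) => //; rewrite hc; apply: le_trans v1.
    by rewrite ler_piMl// flow_sqnorm_ge0.
  exfalso; apply: (convex _ Lv) => //; apply: le_trans wk; rewrite hc.
  by rewrite ler_peMl ?flow_sqnorm_ge0// ltW.
(* For independent vectors the product of the squared norms at time 1 is at least 1, while that of
   [w] exceeds [M ^- 2] by a factor [exp k] at most. *)
have h := nonzero_lattice_cross Lv Lw cn0.
have h2 := le_trans h (sqr_cross_le 1 0 v w).
have w1 : flow_sqnorm 1 0 w <= expR k%:R * M ^- 2.
  by apply: le_trans (flow_sqnorm_addn_le 1 k 0 w) _; rewrite ler_wpM2l ?expR_ge0.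
have h3 : 1 <= M ^- 2 * (expR k%:R * M ^- 2).
  by apply: le_trans h2 _; rewrite ler_pM ?flow_sqnorm_ge0.
have M4 : 0 < M ^+ 4 by rewrite exprn_gt0.
rewrite -(ler_pM2r M4) in h3; rewrite mul1r in h3.
apply: le_trans h3 _; rewrite (_ : _ * M ^+ 4 = expR k%:R)//.
by field; rewrite gt_eqF.
Qed.

Variables (mu : probability X R) (inv : invariant_measure mu T).

(** Among [N] consecutive times, [N] the integer part of [4 * ln M], an orbit enters the cusp at
    most once; averaging gives [N * Pr A <= 1]. The 3 absorbs the rounding, as
    [4 * ln M - 1 >= 3 * ln M]. *)
Lemma Pr_entering_le M : 1 <= ln M -> 0 < M ->
  fine (mu (entering T (height_ge M))) <= (3 * ln M)^-1.
Proof.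
move=> lM M0; set A := entering _ _.
have mY : measurable (height_ge M : set X) := measurable_height_ge M.
have mT := @measurable_geodesic_map R.
have mA : measurable A.
  by apply: measurableI; [exact: measurableC|exact: measurable_preimage].
have l4 : 0 <= 4 * ln M by lra.
have /andP[Nl lN] := truncn_itv l4; set N := Num.trunc _ in Nl lN.
have at_most1 x : \sum_(i < N) \1_A (iter i T x) <= 1 :> R.
  have [[i Ai]|none] := pselect (exists i : 'I_N, A (iter i T x)); last first.
    rewrite big1 ?ler01// => i _; rewrite indicE memNset// => Ai; apply: none.
    by exists i.
  rewrite (bigD1 i)//= indicE mem_set// big1 ?addr0// => j ji.
  rewrite indicE memNset// => Aj.
  suff gap (a b : 'I_N) : (a < b)%N -> A (iter a T x) -> A (iter b T x) -> False.
    have [ij|ij|e] := ltngtP i j; [exact: gap ij Ai Aj|exact: gap ij Aj Ai|].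
    by move: ji; rewrite -val_eqE /= e eqxx.
  move=> ab Aa Ab.
  have := @entering_gap (iter a T x) M (b - a) M0.
  rewrite -iterD subnK ?(ltnW ab)// subn_gt0 ab => /(_ isT Aa Ab).
  rewrite -[M]lnK ?posrE// -expRM_natl ler_expR => h.
  have : (b - a)%:R <= (N%:R - 1 : R).
    by rewrite lerBrDr natr1 ler_nat; have := ltn_ord b; lia.
  move: h Nl; lra.
have mean i : has_mean mu (fun x => \1_A (iter i T x)) (fine (mu A)).
  rewrite -(mu_iter_preimage mT inv i mA).
  by have := has_mean_indic mu (measurable_iter_preimage mT i mA).
have := has_mean_le (has_mean_sum (index_enum 'I_N) mean) (has_mean_cst mu 1) at_most1.
rewrite sumr_const card_ord -[_ *+ N]mulr_natl => h.
have A0 : 0 <= fine (mu A) := Pr_ge0 mu A.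
rewrite -[leRHS]mul1r ler_pdivlMr; last by lra.
rewrite mulrC; apply: le_trans h; rewrite ler_wpM2r//.
by move: lN; rewrite -natr1; lra.
Qed.

End returns_to_the_cusp.

(** * Coding geodesic orbits *)

Section geodesic_coding.
Variable R : realType.
Local Notation X := (SL2ZSL2R R).
Local Notation T := (@geodesic_map R).
Implicit Types (g h b : SL2 R) (M : R) (v w : R * R).

Lemma lower_unipotent_subproof (rho : R) : 1 * 1 - 0 * rho = 1.
Proof. by ring. Qed.
Definition lower_unipotent rho : SL2 R := SL2_of (lower_unipotent_subproof rho).

(** Separates the unstable coordinate [rho] from an upper triangular factor, which the flow never
    expands. *)
Lemma near1_decomp e h : e <= 2^-1 -> near1 e h -> exists rho b,
  [/\ h = SL2_mul (lower_unipotent rho) b, b 1 0 = 0, near1 (2 * e) b & `|rho| <= 1].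
Proof.
move=> e2 [h1 h2 h3 h4]; have e0 : 0 < e by exact: le_lt_trans h1.
have p2 : 2^-1 < h 0 0 by move: h1; rewrite ltr_norml; lra.
have p0 : 0 < h 0 0 by lra.
have pn : h 0 0 != 0 by rewrite gt_eqF.
have bdet : h 0 0 * (h 0 0)^-1 - h 0 1 * 0 = 1 by rewrite divff// mulr0 subr0.
have i2 : (h 0 0)^-1 < 2 by rewrite -[ltRHS]invrK ltf_pV2 ?posrE ?invr_gt0.
exists (h 1 0 / h 0 0), (SL2_of bdet); split.
- apply: SL2P; rewrite SL2_mulE !SL2_ofE ?mul0r ?mul1r ?mulr0 ?addr0 ?divfK//.
  by apply: (mulIf pn); rewrite mulrDl mulrAC mulfVK//; have := SL2_det2 h; lra.
- by rewrite SL2_ofE.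
- have ee : e < 2 * e by lra.
  split; rewrite SL2_ofE; [exact: lt_trans ee|exact: lt_trans ee| |].
    by rewrite normr0; lra.
  have -> : (h 0 0)^-1 - 1 = (1 - h 0 0) * (h 0 0)^-1 by rewrite mulrBl mul1r divff.
  rewrite normrM distrC (ger0_norm (x := _^-1)) ?invr_ge0 ?(ltW p0)//.
  have := ltW p0; rewrite -invr_ge0 => i0.
  by rewrite mulrC; apply: ltr_pM => //.
rewrite normrM (ger0_norm (x := _^-1)) ?invr_ge0 ?(ltW p0)//.
have := ltW p0; rewrite -invr_ge0 => i0; have := normr_ge0 (h 1 0); nra.
Qed.

Lemma conj_powerM j h k : conj_power j (SL2_mul h k) = SL2_mul (conj_power j h) (conj_power j k).
Proof.
by rewrite /conj_power -!SL2_mulA SL2_mulKV.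
Qed.

Lemma near1_conj_upper j e b : b 1 0 = 0 -> near1 e b -> near1 e (conj_power j b).
Proof.
move=> b0 [h1 h2 h3 h4]; have e0 : 0 < e by exact: le_lt_trans h1.
have [e00 e01 e10 e11] := conj_powerE j b.
split; rewrite ?e00 ?e01 ?e10 ?e11 ?b0 ?mulr0 ?normr0//.
rewrite normrM ger0_norm ?expR_ge0//; apply: le_lt_trans h2.
by rewrite ler_piMl// -[leRHS](@expR0 R) ler_expR oppr_le0.
Qed.

Lemma near1_conj_lower j e rho : 0 < e -> `|expR j%:R * rho| < e ->
  near1 e (conj_power j (lower_unipotent rho)).
Proof.
move=> e0 h; have [e00 e01 e10 e11] := conj_powerE j (lower_unipotent rho).
by split; rewrite ?e00 ?e01 ?e10 ?e11 !SL2_ofE ?subrr ?mulr0 ?normr0.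
Qed.

Lemma lower_unipotentD g rho rho' :
  SL2_mul g (lower_unipotent rho') =
  SL2_mul (SL2_mul g (lower_unipotent rho)) (lower_unipotent (rho' - rho)).
Proof.
rewrite -SL2_mulA; congr SL2_mul.
by apply: SL2P; rewrite SL2_mulE !SL2_ofE; ring.
Qed.

(** Part of a Bowen ball: an unstable coordinate known up to [sg * exp (- n)] is still known up to
    [sg] after [n] steps. *)
Definition bowen_piece g n (eta sg c : R) : set X := [set x | exists rho b,
  [/\ x = \pi_X (SL2_mul (SL2_mul g (lower_unipotent rho)) b), b 1 0 = 0, near1 eta b &
  `|rho - c| <= sg * expR (- n%:R)]].

(** The displacement between the two points is the inverse of [b], a shear by [rho' - rho], then
    [b']. The flow does not expand the triangular factors and stretches the shear by at most
    [exp n]; the 16 comes from two uses of [near1_mul]. *)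
Lemma bowen_piece_near g n eta sg c x x' j : (j <= n)%N -> eta <= 4^-1 -> 2 * sg < eta ->
  bowen_piece g n eta sg c x -> bowen_piece g n eta sg c x' ->
  exists y k, [/\ iter j T x = \pi_X y, iter j T x' = \pi_X (SL2_mul y k) & near1 (16 * eta) k].
Proof.
move=> jn eta4 sgeta [rho [b [-> b0 hb hr]]] [rho' [b' [-> b'0 hb' hr']]].
have eta0 : 0 < eta by case: hb => h _ _ _; exact: le_lt_trans h.
set k := SL2_mul (SL2_mul (SL2_inv b) (lower_unipotent (rho' - rho))) b'.
rewrite !iter_geodesic_map.
exists (SL2_mul (SL2_mul (SL2_mul g (lower_unipotent rho)) b) (geodesic_power R j)), (conj_power j k).
split => //.
  rewrite -mul_geodesic_power /k !SL2_mulA SL2_mulK.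
  by rewrite [in LHS](lower_unipotentD g rho rho').
rewrite /k !conj_powerM (_ : 16 * eta = 4 * (4 * eta)); last by lra.
have bi : near1 eta (conj_power j (SL2_inv b)).
  by apply: near1_conj_upper; [rewrite SL2_ofE b0 oppr0|exact: near1_inv].
have bu : near1 eta (conj_power j (lower_unipotent (rho' - rho))).
  apply: near1_conj_lower => //; rewrite normrM ger0_norm ?expR_ge0//.
  have d2 : `|rho' - rho| <= 2 * (sg * expR (- n%:R)).
    have -> : rho' - rho = (rho' - c) + (c - rho) by ring.
    by apply: le_trans (ler_normD _ _) _; rewrite (distrC c); lra.
  have sg0 : 0 <= sg by rewrite -(pmulr_lge0 _ (expR_gt0 (- n%:R))) (le_trans _ hr).
  apply: (@le_lt_trans _ _ (2 * sg * (expR j%:R * expR (- n%:R)))).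
    by have := ler_wpM2l (expR_ge0 j%:R) d2; lra.
  apply: le_lt_trans sgeta; rewrite ler_piMr ?mulr_ge0// -expRD -[leRHS](@expR0 R) ler_expR.
  by rewrite subr_le0 ler_nat.
have bb : near1 (4 * eta) (conj_power j b').
  by apply: near1W (near1_conj_upper j b'0 hb'); lra.
apply: near1_mul bb; first lra.
by apply: near1_mul => //; lra.
Qed.

(** [V] continued by [false] to all times, the form that [pattern_set] takes. *)
Definition visit n (V : {ffun 'I_n -> bool}) (j : nat) : bool := [exists i : 'I_n, (i == j :> nat) && V i].

Lemma visit_ord n (V : {ffun 'I_n -> bool}) (i : 'I_n) : visit V i = V i.
Proof.
apply/existsP/idP => [[k /andP[/eqP e]]|Vi]; last by exists i; rewrite eqxx.
by have -> : k = i by apply: val_inj.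
Qed.

Lemma log_count_visit n (V : {ffun 'I_n -> bool}) :
  log_count R (visit V) n 0 = n%:R - visits R V / 2 + excursion_cost R * entrances R V.
Proof.
rewrite /log_count big_mkord /visits /entrances mulr_suml mulr_sumr.
have -> : n%:R = \sum_(i < n) (1 : R) by rewrite sumr_const card_ord.
rewrite -sumrB -big_split /=; apply: eq_bigr => i _; rewrite visit_ord.
congr (_ + _ * (_ && ~~ _)%:R).
rewrite /previously_visited; case: i => -[|i] hi /=; first by rewrite preceding0.
have hi' : (i < n)%N by exact: ltnW.
by rewrite (precedingS V hi') -(visit_ord V (Ordinal hi')).
Qed.

Lemma flow_sqnorm_lattice_vec g rho j m : flow_sqnorm j rho (lattice_vec g m) =
  sqnorm (lattice_vec (SL2_mul (SL2_mul g (lower_unipotent rho)) (geodesic_power R j)) m).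
Proof.
have E : lattice_vec (SL2_mul g (lower_unipotent rho)) m =
    ((lattice_vec g m).1 + rho * (lattice_vec g m).2, (lattice_vec g m).2).
  by rewrite /lattice_vec !SL2_mulE !SL2_ofE; congr (_, _) => /=; ring.
by rewrite sqnorm_geodesic_power E /flow_sqnorm /= mul0r addr0.
Qed.

(** [b] stays within 1/2 of the identity under conjugation by the flow, so at all times squared
    norms along the orbits of [x] and of the sheared base point agree up to the factor
    [(1 + 2 / 2)^2 = 4]. *)
Lemma pattern_set_visits g b rho n (V : {ffun 'I_n -> bool}) M H x : 0 < M -> 0 < H ->
  x = \pi_X (SL2_mul (SL2_mul g (lower_unipotent rho)) b) -> b 1 0 = 0 -> near1 2^-1 b ->
  height x < H -> (forall j : 'I_n, V j = (iter j T x \in height_ge M)) ->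
  pattern_set (nonzero_lattice g) (visit V) n (4 * M ^- 2) (H ^- 2 / 4) rho.
Proof.
move=> M0 H0 xE b0 hb xH Vx.
have cmp j m :
    sqnorm (lattice_vec (SL2_mul (SL2_mul (SL2_mul g (lower_unipotent rho)) b) (geodesic_power R j)) m)
      <= 4 * flow_sqnorm j rho (lattice_vec g m) /\
    flow_sqnorm j rho (lattice_vec g m) <=
    4 * sqnorm (lattice_vec (SL2_mul (SL2_mul (SL2_mul g (lower_unipotent rho)) b) (geodesic_power R j)) m).
  rewrite flow_sqnorm_lattice_vec mul_geodesic_power; set y := SL2_mul _ (geodesic_power R j).
  have hc := near1_conj_upper j b0 hb; have e4 : (1 + 2 * 2^-1) ^+ 2 = 4 :> R by lra.
  split; first by have := sqnorm_near1 y m hc; rewrite e4.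
  by have := sqnorm_near1 (SL2_mul y (conj_power j b)) m (near1_inv hc); rewrite e4 SL2_mulK.
split.
- move=> _ [m m0 <-]; have [h _] := cmp 0%N m.
  have : H ^- 2 < sqnorm (lattice_vec (SL2_mul (SL2_mul g (lower_unipotent rho)) b) m).
    rewrite ltNge; apply/negP => le; move: xH; rewrite ltNge => /negP; apply.
    by rewrite xE; apply/(height_geP _ H0); exists (lattice_vec (SL2_mul (SL2_mul g (lower_unipotent rho)) b) m) => //; exists m.
  by move: h; rewrite /geodesic_power /= SL2_mul1; lra.
- move=> j jn; rewrite -[j]/(nat_of_ord (Ordinal jn)) visit_ord Vx => /set_mem.
  rewrite xE iter_geodesic_map => /(height_geP _ M0)[_ [m m0 <-] h].
  exists (lattice_vec g m); first by exists m.
  by have [_ h2] := cmp j m; apply: le_trans h2 _; rewrite ler_pM2l.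
move=> j jn; rewrite -[j]/(nat_of_ord (Ordinal jn)) visit_ord Vx => /negP nY _ [m m0 <-].
have [h _] := cmp j m.
have : M ^- 2 < sqnorm (lattice_vec (SL2_mul (SL2_mul (SL2_mul g (lower_unipotent rho)) b) (geodesic_power R j)) m).
  rewrite ltNge; apply/negP => le; apply: nY; apply/mem_set; rewrite xE iter_geodesic_map.
  apply/(height_geP _ M0); eexists; last exact: le.
  by exists m.
by move: h => /=; lra.
Qed.

(** At each time the orbits starting in [B] meet at most one of the sets [K i]; that index is the
    letter, and [i0] fills the times at which none is met. *)
Lemma word_of_piece k (i0 : 'I_k) (K : 'I_k -> set X) n (B : set X) :
  (forall j i i' x x', (j < n)%N -> B x -> B x' -> K i (iter j T x) -> K i' (iter j T x') -> i = i') ->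
  exists b : {ffun 'I_n -> 'I_k}, forall x, B x -> forall (j : 'I_n) i, K i (iter j T x) -> b j = i.
Proof.
move=> h; pose P (j : 'I_n) i := `[< exists2 x, B x & K i (iter j T x) >].
exists [ffun j => odflt i0 [pick i | P j i]] => x Bx j i Ki; rewrite ffunE.
case: pickP => [i' /asboolP[x' Bx' Ki']|/(_ i)/asboolP nP]; last by exfalso; apply: nP; exists x.
exact: h Bx' Bx Ki' Ki.
Qed.

(** Finitely many cells cover the points of height below [H]. In each cell the unstable coordinates
    compatible with [V] are covered by intervals of radius [sg * exp (- n)], and every interval
    gives one Bowen piece, hence one word. The number of cells and the constants of the covering do
    not depend on [n] or [V], and go into [C]. *)
Lemma geodesic_coding k (i0 : 'I_k) (K : 'I_k -> set X) e M H :
  0 < e -> (forall i j, i != j -> separated e (K i) (K j)) -> 4 <= M -> 0 < H ->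
  exists2 C, 0 <= C & forall n (V : {ffun 'I_n -> bool}),
  exists2 cs : seq {ffun 'I_n -> 'I_k},
    (size cs)%:R <= expR (C + n%:R - visits R V / 2 + excursion_cost R * entrances R V) &
    forall x, height x < H -> (forall j : 'I_n, V j = (iter j T x \in height_ge M)) ->
      exists2 b, b \in cs & forall (j : 'I_n) i, K i (iter j T x) -> b j = i.
Proof.
move=> e0 sepK M4 H0.
have M0 : 0 < M by lra.
(* [16 * eta <= e] allows orbits in one piece to be compared by [sepK]; [sg = eta / 4] ensures
   [2 * sg < eta]. *)
pose eta := Num.min e 1 / 16; pose sg := eta / 4.
have [eta0 eta16 etae] : [/\ 0 < eta, eta <= 16^-1 & 16 * eta <= e].
  split; rewrite /eta.
  - by rewrite divr_gt0// lt_min e0 ltr01.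
  - by rewrite ler_pdivrMr// mulVf// ge_min lexx orbT.
  - by rewrite mulrCA divff// mulr1 ge_min lexx.
have sg0 : 0 < sg by rewrite divr_gt0.
have sg1 : sg <= 1 by rewrite /sg; lra.
have eta2 : 0 < eta / 2 by lra.
have [s hs] := finite_cell_cover (ltW H0) eta2.
pose t := 4 * M ^- 2; pose h0 := H ^- 2 / 4.
have M20 : 0 < M ^- 2 by rewrite invr_gt0 exprn_gt0.
have t0 : 0 < t by rewrite mulr_gt0.
have t4 : t <= 4^-1.
  rewrite /t ler_pdivrMr ?exprn_gt0//.
  have : 4 ^+ 2 <= M ^+ 2 by rewrite lerXn2r ?nnegrE// ltW.
  by lra.
have h00 : 0 < h0 by rewrite divr_gt0// invr_gt0 exprn_gt0.
have [Th Th23 tTh] : exists2 Th, 23 <= Th & 8 * t <= Th ^+ 2 * h0.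
  (* As [Th >= 1], [Th ^+ 2 >= Th >= 8 * t / h0]. *)
  pose Th := 23 + 8 * t / h0; have r0 : 0 <= 8 * t / h0 by apply: divr_ge0; [apply: mulr_ge0 => //; exact: ltW|exact: ltW].
  exists Th; first by rewrite lerDl.
  rewrite -ler_pdivrMr// /Th expr2; nra.
pose C0 := (size s)%:R * (3 * ((2 * Th + 1) * sg^-1)).
have C00 : 0 <= C0 by rewrite !mulr_ge0 ?invr_ge0 ?(ltW sg0)//; lra.
exists (ln (1 + C0)); first by rewrite ln_ge0// lerDl.
move=> n V.
have r0 : 0 < sg * expR (- n%:R) by rewrite mulr_gt0 ?expR_gt0.
(* The 3 is the length of the range [[-1, 1]] of [rho], plus 1. *)
pose beta := 3 * ((2 * Th + 1) * sg^-1 * expR (log_count R (visit V) n 0)).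
have ex (i : 'I_(size s)) : exists2 ws : seq {ffun 'I_n -> 'I_k}, (size ws)%:R <= beta &
    forall rho b x, x = \pi_X (SL2_mul (SL2_mul (nth (SL2_1 R) s i) (lower_unipotent rho)) b) ->
      b 1 0 = 0 -> near1 eta b -> `|rho| <= 1 -> height x < H ->
      (forall j : 'I_n, V j = (iter j T x \in height_ge M)) ->
      exists2 w, w \in ws & forall (j : 'I_n) i, K i (iter j T x) -> w j = i.
  set g := nth _ _ _.
  have l0 : 0 <= 2 :> R by [].
  have [cs cs_size cs_cov] := covered_pattern_set0 (visit V)
    (@nonzero_lattice_sqnorm_gt0 R g) (@nonzero_lattice_cross R g) t0 t4 h00 r0 sg0 sg1
    erefl (-1) tTh Th23 l0.
  have /choice[wd hwd] c : exists w : {ffun 'I_n -> 'I_k}, forall x, bowen_piece g n eta sg c x ->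
      forall (j : 'I_n) i, K i (iter j T x) -> w j = i.
    apply: word_of_piece => // j a a' x x' jn Bx Bx' Kx Kx'.
    apply/eqP; apply: contraT => ii'.
    have [||y [h [y1 y2 hh]]] := bowen_piece_near (ltnW jn) _ _ Bx Bx'; [lra|rewrite /sg; lra|].
    exfalso; apply: (sepK _ _ ii' y h); first exact: near1W hh.
      by rewrite -y1.
    by rewrite -y2.
  exists [seq wd c | c <- cs].
    by rewrite size_map; apply: le_trans cs_size _; rewrite /beta; lra.
  move=> rho b x xE b0 hb rho1 xH Vx.
  have hb2 : near1 2^-1 b by apply: near1W hb; lra.
  have rp := pattern_set_visits M0 H0 xE b0 hb2 xH Vx.
  have [|c ccs cr] := cs_cov rho.
    by split => //; move: rho1; rewrite ler_norml /interval_set /=; lra.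
  exists (wd c); first exact: map_f.
  by apply: hwd; exists rho, b.
pose ws i := sval (cid2 (ex i)).
exists (flatten [seq ws i | i <- enum 'I_(size s)]).
  have le1 : (size (flatten [seq ws i | i <- enum 'I_(size s)]))%:R <= (size s)%:R * beta.
    rewrite -[X in _ <= X%:R * _](size_enum_ord (size s)); elim: (enum _) => [|i l IH]; first by rewrite mul0r.
    rewrite /= size_cat natrD -[(size l).+1%:R]natr1 mulrDl mul1r addrC lerD//.
    by rewrite /ws; case: cid2.
  apply: le_trans le1 _; rewrite -!addrA expRD lnK ?posrE; last by rewrite ltr_pwDl.
  rewrite addrA -log_count_visit mulrDl mul1r.
  apply: ler_wpDl; first exact: expR_ge0.
  by rewrite /beta /C0 !mulrA.
move=> x xH Vx; have [i [h hh xE]] := hs x (ltW xH).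
have [|rho [b [hE b0 hb rho1]]] := near1_decomp _ hh; first lra.
have xE' : x = \pi_X (SL2_mul (SL2_mul (nth (SL2_1 R) s i) (lower_unipotent rho)) b).
  by rewrite xE hE SL2_mulA.
have hb' : near1 eta b by apply: near1W hb; lra.
have hws : exists2 w, w \in ws i & forall (j : 'I_n) l, K l (iter j T x) -> w j = l.
  by rewrite /ws; case: cid2 => wi _ /= hwi; exact: hwi xE' b0 hb' rho1 xH Vx.
have [w wws hw] := hws; exists w => //.
by apply/flattenP; exists (ws i) => //; apply: map_f; rewrite mem_enum.
Qed.

End geodesic_coding.

(** * Entropy and escape of mass *)

Lemma limn_div_le (R : realType) (u : nat -> R) (D a : R) :
  0 <= a -> (forall n, u n <= D + n%:R * a) -> limn (fun n => u n / n%:R) <= a.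
Proof.
move=> a0 h.
(* For a divergent sequence [limn] returns the default point [0]. *)
have [cv|/dvgP ->] := pselect (cvgn (fun n => u n / n%:R)); last exact: a0.
apply/ler_addgt0Pr => e e0; apply: limr_le => //.
have [N DN] : exists N : nat, `|D| / e < N.+1%:R.
  have d0 : 0 <= `|D| / e by rewrite divr_ge0// ltW.
  by have /andP[_ ?] := truncn_itv d0; eexists; eassumption.
exists N.+1 => // n /= Nn; have n0 : 0 < n%:R :> R by rewrite ltr0n (leq_trans _ Nn).
rewrite ler_pdivrMr//; apply: le_trans (h n) _; rewrite mulrDl addrC mulrC lerD2l.
apply: le_trans (ler_norm D) _; rewrite -ler_pdivrMl// mulrC.
by apply: le_trans (ltW DN) _; rewrite ler_nat.
Qed.

Section entropy_in_the_cusp.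
Variable R : realType.
Local Notation X := (SL2ZSL2R R).
Local Notation T := (@geodesic_map R).
Implicit Types M : R.

Lemma neg_ln_onem_le (x : R) : 0 <= x -> x <= 2^-1 -> - ln (1 - x) <= 2 * x.
Proof.
move=> x0 x2; have y0 : 0 < 1 - x by lra.
rewrite -lnV ?posrE//.
have := @le_ln1Dx R ((1 - x)^-1 - 1); rewrite addrCA subrr addr0.
have i0 : 0 < (1 - x)^-1 by rewrite invr_gt0.
have i1 : (1 - x)^-1 - 1 <= 2 * x.
  by rewrite lerBlDr -[leLHS]mul1r ler_pdivrMr//; nra.
by move=> h; apply: le_trans (h _) i1; lra.
Qed.

Section measure.
Variables (mu : probability X R) (inv : invariant_measure mu T).
Local Notation Pr A := (fine (mu A)).

Lemma tail_small dlt : 0 < dlt -> exists2 H : R, 0 < H & Pr (height_ge H) < dlt.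
Proof.
move=> d0; have [n hn] : exists n : nat, Pr (height_ge n.+1%:R) < dlt.
  apply: (@Pr_decreasing_small _ _ _ mu (fun n => height_ge n.+1%:R)) => //.
  - by move=> n; exact: measurable_height_ge.
  - move=> n m nm x; rewrite /height_ge /=; apply: le_trans.
    by rewrite ler_nat.
  rewrite -subset0 => x h; have h0 : 0 <= height x by exact/ltW/height_gt0.
  have /andP[_ lt] := truncn_itv h0.
  by have := h (Num.trunc (height x)) I; rewrite /height_ge /= leNgt lt.
by exists n.+1%:R.
Qed.

(** With [M] fixed, the errors are chosen in order: [dlt], making [- ln (1 - dlt)] equal to [e];
    then the separated sets, whose missing measure is weighted by [ln k - ln dlt]; and the height
    [H], whose tail is weighted by [ln k]. Each costs at most [e' / 3]. *)
Lemma entropy_partition_le k (P : 'I_k -> set X) M :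
  (forall i, measurable (P i)) -> partition setT P setT -> 4 <= M -> 2 <= ln M ->
  6 + excursion_cost R <= ln (ln M) ->
  entropy_partition mu T P <= 1 + ln (ln M) / ln M - Pr (height_ge M) / 2.
Proof.
move=> mP partP M4 lM llM; have c0 := excursion_cost_ge0 R.
have [idx hidx] := partition_index partP.
have M0 : 0 < M by lra.
have lM0 : 0 < ln M by lra.
have mY := @measurable_height_ge R M; have mT := @measurable_geodesic_map R.
have k0 : (0 < k)%N by rewrite (leq_ltn_trans _ (ltn_ord (idx point))).
have lnk0 : 0 <= ln (k%:R : R) by rewrite ln_ge0// ler1n.
pose eta := (ln M)^-1.
have eta01 : 0 < eta < 1.
  by rewrite invr_gt0 lM0 invf_lt1//; lra.
apply/ler_addgt0Pr => e' e'0; pose e := e' / 3; have e0 : 0 < e by rewrite divr_gt0.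
pose dlt := 1 - expR (- e).
have dlt01 : 0 < dlt < 1.
  rewrite /dlt; have := expR_gt0 (- e); have : expR (- e) < 1 by rewrite expR_lt1; lra.
  by move=> *; apply/andP; split; lra.
have [dlt0 dlt1] := andP dlt01.
have ldlt : ln dlt <= 0 by rewrite ln_le0// ltW.
have ldlt' : ln (1 - dlt) = - e by rewrite /dlt opprB addrC subrK expRK.
have a1 : 0 < ln k%:R - ln dlt + 1 :> R by lra.
have a2 : 0 < ln k%:R + 1 :> R by lra.
have [sep [K [sep0 mK KP sepK K0]]] :=
  separated_partition mu mP partP (divr_gt0 e0 a1).
have [H H0 HP] := tail_small (divr_gt0 e0 a2).
have [C C0 coding] := geodesic_coding (idx point) sep0 sepK M4 H0.
have mG : measurable (~` height_ge H : set X) by apply: measurableC; exact: measurable_height_ge.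
have coding' n (V : {ffun 'I_n -> bool}) :
  exists2 cs : seq {ffun 'I_n -> 'I_k},
    (size cs)%:R <= expR (C + n%:R - visits R V / 2 + excursion_cost R * entrances R V) &
    forall x, (~` height_ge H) x -> (forall j : 'I_n, V j = (iter j T x \in height_ge M)) ->
      exists2 b, b \in cs & forall (j : 'I_n) i, K i (iter j T x) -> b j = i.
  have [cs cs_size h] := coding n V; exists cs => // x /negP nx; apply: h.
  by move: nx; rewrite -ltNge.
have [D hD] := entropy_bound_from_coding mT inv mP partP mK KP mY mG c0 C0 eta01 dlt01 coding'.
have A0 := Pr_ge0 mu (entering T (height_ge M)).
have A1 : Pr (entering T (height_ge M)) <= (3 * ln M)^-1.
  by apply: Pr_entering_le => //; lra.
have Y1 : Pr (height_ge M) <= 1.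
  have := Pr_le mu mY measurableT (@subsetT _ _).
  by rewrite [X in _ <= fine X](probability_setT mu).
have leta : ln eta = - ln (ln M) by rewrite lnV ?posrE.
have leta1 : - ln (1 - eta) <= 2 * eta.
  apply: neg_ln_onem_le; first by case/andP: eta01 => /ltW.
  by rewrite /eta lef_pV2 ?posrE.
have leta0 : ln (1 - eta) <= 0.
  by rewrite ln_le0// gerBl; case/andP: eta01 => /ltW.
rewrite ler_pdivlMr// in K0; rewrite ltr_pdivlMr// in HP.
rewrite setCK in hD.
have K00 := Pr_ge0 mu (~` \bigcup_i K i).
have HP0 := Pr_ge0 mu (height_ge H : set X).
apply: le_trans (limn_div_le _ hD) _.
  (* [limn_div_le] asks for a nonnegative rate; the cusp has mass at most 1, so the negative term is
     at most 1/2. *)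
  rewrite ldlt' leta; have : 0 <= (excursion_cost R - 2 * - ln (ln M)) * Pr (entering T (height_ge M)).
    by rewrite mulr_ge0//; lra.
  have : 0 <= (ln k%:R - ln dlt) * Pr (~` \bigcup_i K i) by rewrite mulr_ge0//; lra.
  have : 0 <= ln k%:R * Pr (height_ge H) by rewrite mulr_ge0.
  lra.
have h1 : (ln k%:R - ln dlt) * Pr (~` \bigcup_i K i) <= e by move: K0 K00; lra.
have h2 : ln k%:R * Pr (height_ge H) <= e by move: HP HP0; lra.
have h3 : (excursion_cost R - 2 * ln eta) * Pr (entering T (height_ge M)) <=
    (excursion_cost R + 2 * ln (ln M)) * (eta / 3).
  rewrite leta mulrN opprK ler_wpM2l//; first lra.
  by rewrite /eta -invfM mulrC.
(* Multiplied by [ln M], this is [2 + (excursion_cost R + 2 y) / 3 <= y] for [y = ln (ln M)], that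
   is [6 + excursion_cost R <= y]. *)
have h4 : 2 * eta + (excursion_cost R + 2 * ln (ln M)) * (eta / 3) <= ln (ln M) / ln M.
  rewrite -/eta; have eta0 : 0 < eta by case/andP: eta01.
  rewrite (_ : 2 * eta + _ = (2 + (excursion_cost R + 2 * ln (ln M)) / 3) * eta); last by lra.
  by rewrite ler_pM2r//; lra.
rewrite ldlt'; move: h1 h2 h3 h4 leta1; rewrite /e; lra.
Qed.

Lemma measure_entropy_le M : 4 <= M -> 2 <= ln M -> 6 + excursion_cost R <= ln (ln M) ->
  (measure_entropy mu T <= (1 + ln (ln M) / ln M - Pr (height_ge M) / 2)%:E)%E.
Proof.
move=> M4 lM llM; apply: ge_ereal_sup => _ [k [P [mP partP ->]]].
by rewrite lee_fin; exact: entropy_partition_le.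
Qed.

End measure.

(** * From the entropy bound to escape of mass *)

Definition cusp_threshold : R := expR (expR (6 + excursion_cost R)).

Lemma cusp_thresholdP M : cusp_threshold <= M ->
  [/\ 4 <= M, 2 <= ln M & 6 + excursion_cost R <= ln (ln M)].
Proof.
move=> hM; have c0 := excursion_cost_ge0 R.
have e1 := expR_ge1Dx (6 + excursion_cost R).
have e2 := expR_ge1Dx (expR (6 + excursion_cost R)).
have M0 : 0 < M by apply: lt_le_trans hM; exact: expR_gt0.
have l1 : expR (6 + excursion_cost R) <= ln M.
  by rewrite -[leLHS]expRK ler_ln ?posrE ?expR_gt0.
have lM0 : 0 < ln M by apply: lt_le_trans l1; exact: expR_gt0.
split; [by move: hM; rewrite /cusp_threshold; lra|lra|].
by rewrite -[leLHS]expRK ler_ln ?posrE ?expR_gt0.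
Qed.

(** For [M = exp (exp s)] the quotient is [s / exp s], and [exp s >= 1 + s^2 / 2] makes it small
    once [s >= 2 / e]. *)
Lemma loglog_small (e : R) : 0 < e -> exists2 M, cusp_threshold <= M & ln (ln M) / ln M <= e.
Proof.
move=> e0; have c0 := excursion_cost_ge0 R.
pose s := 6 + excursion_cost R + 2 / e.
have s0 : 0 < s by rewrite /s addr_gt0 ?divr_gt0//; lra.
exists (expR (expR s)).
  by rewrite !ler_expR lerDl divr_ge0// ltW.
rewrite !expRK ler_pdivrMr ?expR_gt0//.
have := expR_ge1Dxn 1 (ltW s0); rewrite (_ : 2`! = 2)%N// => h.
have es : 2 <= e * s.
  by rewrite -ler_pdivrMl// mulrC /s lerDr; lra.
have : e * (1 + s ^+ 2 / 2) <= e * expR s by rewrite ler_pM2l.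
by nra.
Qed.

(** Piecewise linear in the height: 1 up to [M], 0 from [2 * M] on. The absolute values make
    continuity a matter of composition. *)
Definition cusp_cutoff M (x : X) : R := (`|2 - height x / M| - `|1 - height x / M| + 1) / 2.

Lemma cusp_cutoff_bounds M x : 0 < M ->
  [/\ 0 <= cusp_cutoff M x, cusp_cutoff M x <= 1,
      height x < M -> cusp_cutoff M x = 1 & cusp_cutoff M x != 0 -> height x <= 2 * M].
Proof.
move=> M0; rewrite /cusp_cutoff.
have lt1 : height x < M -> height x / M < 1 by rewrite ltr_pdivrMr// mul1r.
have le2 : height x / M <= 2 -> height x <= 2 * M by rewrite ler_pdivrMr.
move: lt1 le2; set y := height x / M => lt1 le2.
split.
- by case: (ger0P (2 - y)) => ?; case: (ger0P (1 - y)) => ?; lra.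
- by case: (ger0P (2 - y)) => ?; case: (ger0P (1 - y)) => ?; lra.
- by move=> /lt1 y1; rewrite !ger0_norm; lra.
- have [//|y2] := leP y 2; first by move=> /le2.
  by rewrite !ltr0_norm; [|lra|lra]; rewrite (_ : _ / 2 = 0) ?eqxx//; lra.
Qed.

Lemma cusp_cutoff_continuous M : continuous (cusp_cutoff M).
Proof.
pose g (y : R) : R := (`|2 - y / M| - `|1 - y / M| + 1) / 2.
have cg : continuous g.
  move=> y; have h (a : R) : a - z / M @[z --> y] --> a - y / M.
    by apply: cvgB; [exact: cvg_cst|apply: cvgM => //; exact: cvg_cst].
  apply: cvgM; last exact: cvg_cst.
  apply: cvgD; last exact: cvg_cst.
  by apply: cvgB; apply: cvg_norm; exact: h.
by move=> x; apply: (@continuous_comp _ _ _ (@height R) g); [exact: height_continuous|exact: cg].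
Qed.

Lemma cusp_cutoff_compact M : 0 < M -> compact (closure [set x | cusp_cutoff M x != 0]).
Proof.
move=> M0; have cl : closed [set x : X | height x <= 2 * M].
  by apply: (@preimage_closed _ _ (@height R) [set y | y <= 2 * M]);
    [move=> x _; exact: height_continuous|exact: closed_le].
apply: (@compact_height_le _ _ (2 * M)); first by rewrite mulr_ge0// ltW.
  exact: closed_closure.
rewrite [X in _ `<=` X]((closure_id _).1 cl); apply: closure_subset => x /= nz.
by have [_ _ _] := cusp_cutoff_bounds x M0; exact.
Qed.

Lemma measurable_cusp_cutoff M :
  measurable_fun [set: X] (fun x : X => (cusp_cutoff M x)%:E).
Proof.
apply/measurable_EFinP; apply: (measurability _ (RGenOpens.measurableE R)).
move=> _ [_ [a [b ->] <-]]; rewrite setTI; apply: open_measurable_surface.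
by apply: open_comp; [move=> x _; exact: cusp_cutoff_continuous|exact: interval_open].
Qed.

Lemma integral_cusp_cutoff_le (mu : {measure set X -> \bar R}) M : 0 < M ->
  (\int[mu]_x (cusp_cutoff M x)%:E <= mu setT)%E.
Proof.
move=> M0; rewrite -[leRHS]mul1e -integral_cst//.
apply: ge0_le_integral => //.
- by move=> x _; have [h _ _ _] := cusp_cutoff_bounds x M0; rewrite lee_fin.
- exact: measurable_cusp_cutoff.
- by move=> x _; have [_ h _ _] := cusp_cutoff_bounds x M0; rewrite lee_fin.
Qed.

Lemma integral_cusp_cutoff_ge (mu : {measure set X -> \bar R}) M : 0 < M ->
  (mu (~` height_ge M) <= \int[mu]_x (cusp_cutoff M x)%:E)%E.
Proof.
move=> M0; have mG : measurable (~` height_ge M : set X).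
  by apply: measurableC; exact: measurable_height_ge.
have -> : mu (~` height_ge M) = (\int[mu]_x (\1_(~` height_ge M) x)%:E)%E.
  by rewrite integral_indic// setIT.
apply: ge0_le_integral => //.
- exact/measurable_EFinP/measurable_indic.
- exact: measurable_cusp_cutoff.
move=> x _; have [h0 _ h1 _] := cusp_cutoff_bounds x M0; rewrite lee_fin indicE.
have [hx|hx] := boolP (x \in _); last exact: h0.
rewrite h1//; move/set_mem: hx; rewrite /height_ge /= => /negP.
by rewrite -ltNge.
Qed.

(** The entropy bound at [M] leaves each [mu_ i] at least this mass below height [M]. The cutoff
    dominates the indicator of that region, is at most 1 and has compact support, so it carries the
    bound to the limit. *)
Lemma mass_ge (c : R) (mu_ : nat -> probability X R) (mu : {measure set X -> \bar R}) M :
  cusp_threshold <= M -> (forall i, invariant_measure (mu_ i) T) ->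
  (forall i, (c%:E <= measure_entropy (mu_ i) T)%E) -> weak_star_limit mu_ mu ->
  ((2 * c - 1 - 2 * (ln (ln M) / ln M))%:E <= mu setT)%E.
Proof.
move=> /cusp_thresholdP[M4 lM llM] inv hc [phi _ cvg_mu].
have M0 : 0 < M by lra.
have cv := cvg_mu _ (cusp_cutoff_continuous (M := M)) (cusp_cutoff_compact M0).
apply: le_trans (integral_cusp_cutoff_le mu M0).
apply: (cvge_to_ge cv); apply: nearW => n /=.
apply: le_trans (integral_cusp_cutoff_ge _ M0).
have mY := @measurable_height_ge R M.
have := le_trans (hc (phi n)) (measure_entropy_le (inv _) M4 lM llM).
rewrite lee_fin => h.
apply: (@le_trans _ _ (fine (mu_ (phi n) (~` height_ge M)))%:E); last first.
  rewrite le_eqVlt; apply/orP; left; apply/eqP.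
  exact: fineK (mu_fin (mu_ (phi n)) (measurableC mY)).
by rewrite lee_fin (Pr_setC (mu_ (phi n)) mY); lra.
Qed.

End entropy_in_the_cusp.

Theorem theorem5p1 (R : realType) :
  (exists M0 : R,
     forall mu : probability (SL2ZSL2R R) R,
     invariant_measure mu (@geodesic_map R) ->
     forall M : R, M0 <= M ->
     (measure_entropy mu (@geodesic_map R) <=
      (1 + ln (ln M) / ln M - fine (mu (height_ge M)) / 2)%:E)%E)
  /\
  (forall (c : R) (mu_ : nat -> probability (SL2ZSL2R R) R)
          (mu : {measure set (SL2ZSL2R R) -> \bar R}),
     (forall i, invariant_measure (mu_ i) (@geodesic_map R)) ->
     (forall i, (c%:E <= measure_entropy (mu_ i) (@geodesic_map R))%E) ->
     weak_star_limit mu_ mu ->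
     ((2 * c - 1)%:E <= mu [set: SL2ZSL2R R])%E).
Proof.
split.
  exists (cusp_threshold R) => mu inv M /cusp_thresholdP[M4 lM llM].
  exact: measure_entropy_le.
move=> c mu_ mu inv hc lim; apply/lee_addgt0Pr => e e0.
(* The limit measure does not depend on [M], so [M] may be taken as large as [e] requires. *)
have e2 : 0 < e / 2 by rewrite divr_gt0.
have [M hM le] := loglog_small e2.
have := mass_ge hM inv hc lim.
case: (mu setT) => [y| |] h.
- by rewrite -EFinD lee_fin; move: h; rewrite lee_fin; lra.
- by rewrite addye// leey.
- by move: h; rewrite leeNy_eq.
Qed.
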